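(* Let $X$ be a centered stationary Gaussian process on $\mathbb{R}$ whose spectral measure $\mu$ is a symmetric Borel probability measure on $\mathbb{R}$ having a nontrivial absolutely continuous part with respect to Lebesgue measure. Suppose that for some $\gamma>1/2$ and some constant $K_0>0$ the moments of $\mu$ satisfy $\log C_n\le K_0\,n^{1+\frac1\gamma}$ for every $n\in\mathbb{N}$, $n\ge1$. Then there exist constants $K,\tilde c>0$ such that for every $n\in\mathbb{N}$, $n\ge1$, $$\mathbb{P}(\mathscr{N}_1\ge n)\le K\exp\left(-\tilde c\,(\log n)^{2\gamma}\right),$$ and there exists a constant $c>0$ such that for every $m\in\mathbb{N}$, $m\ge1$, $$\mathbb{E}[\mathscr{N}_1^m]\le\exp\left(c\,m^{1+\frac{1}{2\gamma-1}}\right).$$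
   Context: The spectral measure $\mu$ of a centered stationary Gaussian process $X$ on $\mathbb{R}$ is the measure such that $\mathbb{E}[X_tX_0]=\int_{\mathbb{R}}e^{-itx}\,d\mu(x)$; a version with smooth sample paths is taken. $C_n:=\int_{\mathbb{R}}|x|^n\,d\mu(x)$ (all finite). $\mathscr{N}_1:=\#\{x\in[0,1]: X_x=0\}$. ''Symmetric'' means $\mu(-A)=\mu(A)$ for all Borel $A$. *)

(* Defs.v *)
From HB Require Import structures.
From mathcomp Require Import all_boot all_order all_algebra.
From mathcomp Require Import all_classical all_reals all_analysis.
Import Order.TTheory GRing.Theory Num.Theory.
Import numFieldNormedType.Exports.

Set Implicit Arguments.
Unset Strict Implicit.
Unset Printing Implicit Defensive.

Local Open Scope classical_set_scope.
Local Open Scope ring_scope.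

Section processes.
Context (R : realType) (d : measure_display) (T : measurableType d)
  (P : probability T R).
Implicit Type X : R -> {RV P >-> R}.

(* The library's normal_prob m s is a junk value (the uniform law on [0, 1])
   when s = 0; the Gaussian law of standard deviation 0 is a Dirac mass. *)
Definition gaussian_law (m s : R) (A : set (measurableTypeR R)) : \bar R :=
  if s == 0 then \d_m A else normal_prob m s A.

Definition gaussian_rv (Y : T -> R) : Prop :=
  exists m s : R, forall A : set (measurableTypeR R), measurable A ->
    P (Y @^-1` A) = gaussian_law m s A.

Definition gaussian_process X : Prop :=
  forall (n : nat) (t a : 'I_n -> R),
    gaussian_rv (fun w => \sum_(i < n) a i * X (t i) w).

Definition centered X : Prop := forall t : R, 'E_P[X t]%E = 0%E.

Definition stationary X : Prop :=
  forall (n : nat) (t : n.-tuple R) (h : R)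
    (B : set (n.-tuple (measurableTypeR R))), measurable B ->
    P [set w | B [tuple X (tnth t i + h) w | i < n]] =
    P [set w | B [tuple X (tnth t i) w | i < n]].

Definition smooth_paths X : Prop :=
  forall (w : T) (k : nat) (x : R),
    derivable (derive1n k (fun y : R => X y w : R^o)) x 1.

(* E[X_t X_0] = \int e^{-itx} dmu(x), split into real and imaginary parts. *)
Definition is_spectral_measure X
    (mu : probability (measurableTypeR R) R) : Prop :=
  forall t : R,
    'E_P[(fun w => X t w * X 0 w)%R]%E = (\int[mu]_x (cos (- (t * x)))%:E)%E /\
    0%E = (\int[mu]_x (sin (- (t * x)))%:E)%E.

Definition nb_zeros01 X (w : T) : \bar R :=
  counting [set x : R | x \in `[0, 1]%R /\ X x w = 0].

End processes.

Section measures_on_the_line.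
Context (R : realType).
Implicit Type mu : {measure set (measurableTypeR R) -> \bar R}.

Definition symmetric_measure mu : Prop :=
  forall A : set (measurableTypeR R), measurable A ->
    mu [set - (x : R) | x in A] = mu A.

Definition lebesgue_singular mu : Prop :=
  exists N : set (measurableTypeR R),
    [/\ measurable N, (@lebesgue_measure R) N = 0%E & mu (~` N) = 0%E].

(* In the Lebesgue decomposition mu = mu_ac + mu_s, which is unique, mu_ac
   is not the zero measure. *)
Definition has_nontrivial_ac_part mu : Prop :=
  exists mu_ac mu_s : {measure set (measurableTypeR R) -> \bar R},
    [/\ mu_ac `<< @lebesgue_measure R,
        lebesgue_singular mu_s,
        forall A : set (measurableTypeR R), measurable A ->
          mu A = (mu_ac A + mu_s A)%E
      & mu_ac setT != 0%E].

Definition finite_moments mu : Prop :=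
  forall n : nat, mu.-integrable setT (fun x : R => (`|x| ^+ n)%:E).

(* C_n; real-valued, hence meaningful only under finite_moments *)
Definition abs_moment mu (n : nat) : R := (\int[mu]_x (`|x| ^+ n))%R.

End measures_on_the_line.

(* Main.v *)
Require Import Defs.
From HB Require Import structures.
From mathcomp Require Import all_boot all_order all_algebra finmap.
From mathcomp Require Import all_classical all_reals all_analysis.
From mathcomp Require Import measurable_realfun ring lra.
Import Order.TTheory GRing.Theory Num.Theory.
Import numFieldNormedType.Exports.

Set Implicit Arguments.
Unset Strict Implicit.
Unset Printing Implicit Defensive.

Local Open Scope classical_set_scope.
Local Open Scope ring_scope.

(** A path with many zeros is flat somewhere, and flatness is unlikely.

    Let [L = ln n]. Suppose that there are [n] zeros in [[0, 1]], and cut this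
    interval into [N] cells, with [N] about [n ^ (1 / 2)]. Some cell contains [m.+1]
    zeros, where [m] is a small multiple of [L ^ gamma] ([zeros_pigeonhole]). By the
    theorem of Rolle every derivative of order at most [m] vanishes in that
    cell, hence the derivative of order [j] is at most [N ^ - (m - j) * M] there,
    where [M] bounds the mean of the modulus of the derivative of order [m.+1]
    over [[0, 1]] ([small_derivatives]).

    The growth of the moments of [mu] bounds the variance of this highest
    derivative by about [exp (m L / 16)]. By [exp_sqr_integral_path] and
    [exp_sqr_integral_bound], [M = exp (m L / 16)] is allowed outside an event
    whose probability is a double exponential, much smaller than needed. On the
    remaining event, at one of the [N] left ends [t] of the cells, the variables
    [X^(2j)(t)] with [j < k] are all at most [exp (- m L / 16)].

    This is where the absolutely continuous part of [mu] enters. A polynomial is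
    small in [L^2 (mu)] only if its coefficients are small
    ([sqr_poly_integral_lower]), so that the variance of a combination of the
    [X^(2j)(t)] is bounded below by [exp (- C k log k)] times the sum of the squares
    of its coefficients. The event for [t] then has probability at most
    [exp (- k m L / 32)] ([small_ball], [derivatives_small_ball]). For [k] of order
    [L ^ (gamma - 1)] the exponent is of order [L ^ (2 gamma)], and the factor [N]
    does not matter because [2 gamma > 1]. The two events are combined in
    [many_zeros_bound], and the scales are fixed in [tail_parameters].

    The Gaussian character of the derivatives is used only through the
    characteristic function and the exponential square moments of their finite
    combinations. The class [normal_like] records both and is closed under
    pointwise limits, hence [normal_like_jet] reaches derivatives of all orders
    from difference quotients.

    For the moments, the mean of the [m]-th power is at most the sum over [n] of
    [n ^ m] times the tail at [n], and the maximum over [L] of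
    [(m + 2) L - c L ^ (2 gamma)] has order [m ^ (1 + 1 / (2 gamma - 1))]
    ([moments_of_tail]). *)

(** * Integrals against normal laws *)

Section density.
Context d (T : measurableType d) (R : realType).
Variables (mu nu : {measure set T -> \bar R}) (g : T -> R).
Hypothesis mg : measurable_fun setT g.
Hypothesis g0 : forall x, 0 <= g x.
Hypothesis nuE : forall A, measurable A -> nu A = (\int[mu]_(x in A) (g x)%:E)%E.

Import HBNNSimple.

Let integral_density_nnsfun (f : {nnsfun T >-> R}) :
  (\int[nu]_x (f x)%:E = \int[mu]_x ((f x)%:E * (g x)%:E))%E.
Proof.
under [LHS]eq_integral do rewrite fimfunE -fsumEFin//.
rewrite [LHS]ge0_integral_fsum//; last 2 first.
  - by move=> r; exact/measurable_EFinP/measurableT_comp.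
  - by move=> n x _; rewrite EFinM nnfun_muleindic_ge0.
under [RHS]eq_integral.
  move=> x xD; rewrite fimfunE -fsumEFin// muleC ge0_mule_fsumr; last first.
    by move=> r; rewrite EFinM nnfun_muleindic_ge0.
  over.
rewrite [RHS]ge0_integral_fsum//; last 2 first.
  - move=> r; apply/measurable_EFinP; apply: measurable_funM => //.
    exact: measurableT_comp.
  - move=> n x _; rewrite EFinM mule_ge0//; last by rewrite nnfun_muleindic_ge0.
    by rewrite lee_fin.
apply: eq_fsbigr => r _; rewrite integralZl_indic_nnsfun//= integral_indic// setIT.
rewrite nuE//.
have [->|rf] := eqVneq (f @^-1` [set r]) set0.
  rewrite integral_set0 mule0 integral0_eq// => x _.
  by rewrite indicE in_set0 /= mulr0 mule0.
have r0 : 0 <= r by move/set0P : rf => [x /= <-].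
rewrite -ge0_integralZl//; last 2 first.
- by apply/measurable_EFinP/measurable_funTS.
- by move=> x _; rewrite lee_fin.
rewrite integral_mkcond; apply: eq_integral => x _.
rewrite patchE indicE; case: ifPn => /= _; rewrite ?mulr1 ?mulr0 ?mule0//.
by rewrite muleC.
Qed.

Lemma ge0_integral_density (f : T -> \bar R) :
  measurable_fun setT f -> (forall x, 0 <= f x)%E ->
  (\int[nu]_x f x = \int[mu]_x (f x * (g x)%:E))%E.
Proof.
move=> mf f0; pose f_ := nnsfun_approx measurableT mf.
transitivity (limn (fun n => \int[nu]_x (f_ n x)%:E)%E).
  rewrite -monotone_convergence//=.
  - apply: eq_integral => ? /[!inE] xD; apply/esym/cvg_lim => //=.
    exact: cvg_nnsfun_approx.
  - by move=> n; exact/measurable_EFinP/measurable_funTS.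
  - by move=> n ? _; rewrite lee_fin.
  - by move=> ? _ ? ? mn; rewrite lee_fin; exact/lefP/nd_nnsfun_approx.
transitivity (limn (fun n => \int[mu]_x ((f_ n x)%:E * (g x)%:E))%E).
  by congr (limn _); apply/funext => n; rewrite integral_density_nnsfun.
rewrite -monotone_convergence//=.
- apply: eq_integral => x /[!inE] xD.
  under eq_fun do rewrite muleC.
  rewrite limeMl//.
  + by rewrite muleC; congr (_ * _)%E; apply/cvg_lim => //; exact: cvg_nnsfun_approx.
  + by apply/cvg_ex; exists (f x); exact: cvg_nnsfun_approx.
- by move=> n; apply: emeasurable_funM; apply/measurable_EFinP/measurable_funTS.
- by move=> n x _; rewrite -EFinM lee_fin mulr_ge0.
- move=> x _ a b ab; rewrite lee_pmul//= ?lee_fin//.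
  exact/lefP/nd_nnsfun_approx.
Qed.

Lemma integral_density (f : T -> R) : measurable_fun setT f ->
  (\int[nu]_x (f x)%:E = \int[mu]_x (f x * g x)%:E)%E.
Proof.
move=> mf; rewrite integralE [RHS]integralE; congr (_ - _)%E.
- rewrite ge0_integral_density//; last first.
    by apply: measurable_funepos; exact/measurable_EFinP.
  apply: eq_integral => x _; rewrite !funeposE -!EFin_max -EFinM; congr (_%:E).
  by rewrite maxr_pMl// mul0r.
- rewrite ge0_integral_density//; last first.
    by apply: measurable_funeneg; exact/measurable_EFinP.
  apply: eq_integral => x _; rewrite !funenegE -!EFinN -!EFin_max -EFinM; congr (_%:E).
  by rewrite maxr_pMl// mul0r mulNr.
Qed.

Lemma integrable_density (f : T -> R) : measurable_fun setT f ->
  nu.-integrable setT (EFin \o f) ->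
  mu.-integrable setT (fun x => (f x * g x)%:E).
Proof.
move=> mf /integrableP[_ fi]; apply/integrableP; split.
  by apply/measurable_EFinP; exact: measurable_funM.
under eq_integral do rewrite /= normrM (ger0_norm (g0 _)) EFinM.
rewrite -(@ge0_integral_density (fun x => `|(f x)%:E|%E))//.
by apply: measurableT_comp => //; exact/measurable_EFinP.
Qed.

End density.

Section normal_integrals.
Context {R : realType}.
Implicit Types m s a h : R.
Local Notation leb := (@lebesgue_measure R).

Lemma ge0_integral_normal_prob m s (f : measurableTypeR R -> \bar R) :
  measurable_fun setT f -> (forall x, 0 <= f x)%E ->
  (\int[normal_prob m s]_x f x = \int[leb]_x (f x * (normal_pdf m s x)%:E))%E.
Proof.
move=> mf f0; apply: ge0_integral_density => //.
- exact: measurable_normal_pdf.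
- exact: normal_pdf_ge0.
Qed.

Lemma integral_normal_prob m s (f : measurableTypeR R -> R) :
  measurable_fun setT f ->
  (\int[normal_prob m s]_x (f x)%:E = \int[leb]_x (f x * normal_pdf m s x)%:E)%E.
Proof.
move=> mf; apply: integral_density => //.
- exact: measurable_normal_pdf.
- exact: normal_pdf_ge0.
Qed.

Lemma integrable_normal_prob m s (f : measurableTypeR R -> R) :
  measurable_fun setT f -> (normal_prob m s).-integrable setT (EFin \o f) ->
  leb.-integrable setT (fun x => (f x * normal_pdf m s x)%:E).
Proof.
move=> mf; apply: integrable_density => //.
- exact: measurable_normal_pdf.
- exact: normal_pdf_ge0.
Qed.

(** The common shape of the explicit normal integrals: [f] turns one normal
    density into a multiple of another one. *)
Lemma integral_normal_scale m s m' s' (c : R) (f : measurableTypeR R -> R) :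
  measurable_fun setT f -> (forall x, 0 <= f x) -> 0 <= c ->
  (forall x, f x * normal_pdf m s x = c * normal_pdf m' s' x) ->
  (\int[normal_prob m s]_x (f x)%:E = c%:E)%E.
Proof.
move=> mf f0 c0 fE; rewrite ge0_integral_normal_prob; last 2 first.
- exact/measurable_EFinP.
- by move=> x; rewrite lee_fin.
under eq_integral do rewrite -EFinM fE EFinM.
rewrite ge0_integralZl => [||||//].
- by rewrite integral_normal_pdf mule1.
- exact: measurableT.
- by apply/measurable_EFinP; exact: measurable_normal_pdf.
- by move=> x _; rewrite lee_fin normal_pdf_ge0.
Qed.

(** By completing the square, the integrand is a multiple of the density of
    the normal law of mean [m + h * s ^ 2]. *)
Lemma normal_mgf m s h : s != 0 ->
  (\int[normal_prob m s]_x (expR (h * x))%:E =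
   (expR (h * m + h ^+ 2 * s ^+ 2 / 2))%:E)%E.
Proof.
move=> s0; apply: (@integral_normal_scale _ _ (m + h * s ^+ 2) s).
- by apply: measurableT_comp => //; exact: mulrl_measurable.
- by move=> x; exact: expR_ge0.
- exact: expR_ge0.
move=> x; rewrite !normal_pdfE// /normal_fun.
rewrite mulrCA [RHS]mulrCA -!expRD; congr (_ * expR _).
by rewrite -mulr_natr; field.
Qed.

(** The integrand is [sqrt 2] times the density of the normal law of standard
    deviation [sqrt 2 * s]. *)
Lemma normal_exp_sqr s : s != 0 ->
  (\int[normal_prob 0 s]_x (expR (x ^+ 2 / (4 * s ^+ 2)))%:E =
   (Num.sqrt 2)%:E)%E.
Proof.
move=> s0.
have s20 : Num.sqrt 2 * s != 0 :> R by rewrite mulf_neq0// gt_eqF// sqrtr_gt0.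
apply: (@integral_normal_scale _ _ 0 (Num.sqrt 2 * s)).
- apply: measurableT_comp => //; apply: measurable_funM => //.
- by move=> x; exact: expR_ge0.
- exact: sqrtr_ge0.
move=> x; rewrite !normal_pdfE// /normal_fun /normal_peak.
rewrite [in RHS]exprMn sqr_sqrtr//.
have -> : Num.sqrt (2 * s ^+ 2 * pi *+ 2) = Num.sqrt 2 * Num.sqrt (s ^+ 2 * pi *+ 2).
  by rewrite -(mulrA 2) -mulrnAr sqrtrM.
rewrite [(Num.sqrt 2 * _)^-1]invfM -[in RHS]mulrA mulVKf; last first.
  by rewrite gt_eqF// sqrtr_gt0.
rewrite mulrCA -expRD; congr (_ * expR _).
have sqE (y : R) : y ^+ 2 / (4 * s ^+ 2) + - (y - 0) ^+ 2 / (s ^+ 2 *+ 2) =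
    - (y - 0) ^+ 2 / (2 * s ^+ 2 *+ 2).
  have : s ^+ 2 != 0 by rewrite expf_neq0.
  rewrite subr0; move: (s ^+ 2) (y ^+ 2) => u v u0.
  by rewrite -(mulr_natr u) -(mulr_natr (2 * u)); field.
exact: sqE.
Qed.

End normal_integrals.

Section real_line_ftc.
Context {R : realType}.
Local Notation leb := (@lebesgue_measure R).

Lemma is_derive_continuous (F f : R -> R) :
  (forall x : R, is_derive x 1 F (f x)) -> continuous F.
Proof.
move=> dF x; apply/differentiable_continuous/derivable1_diffP.
exact: (@ex_derive _ _ _ _ _ _ _ (dF x)).
Qed.

Lemma is_derive_integral (F f : R -> R) (a b : R) : a <= b ->
  (forall x : R, is_derive x 1 F (f x)) -> continuous f ->
  (\int[leb]_(x in `[a, b]) (f x)%:E = (F b - F a)%:E)%E.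
Proof.
rewrite le_eqVlt => /predU1P[<- _ _|ab dF cf].
  by rewrite set_itv1 integral_set1 subrr.
have cF := is_derive_continuous dF.
rewrite (@continuous_FTC2 _ f F)//.
- exact: continuous_subspaceT.
- split => [x _||]; first exact: (@ex_derive _ _ _ _ _ _ _ (dF x)).
  + by apply: cvg_at_right_filter; exact: cF.
  + by apply: cvg_at_left_filter; exact: cF.
- by move=> x _; rewrite derive1E; exact: (@derive_val _ _ _ _ _ _ _ (dF x)).
Qed.

(** The fundamental theorem on [[- n, n]], and dominated convergence. *)
Lemma is_derive_integralT0 (F f : R -> R) :
  (forall x : R, is_derive x 1 F (f x)) -> continuous f ->
  leb.-integrable setT (EFin \o f) ->
  F n%:R @[n --> \oo] --> (0 : R) -> F (- n%:R) @[n --> \oo] --> (0 : R) ->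
  (\int[leb]_x (f x)%:E = 0)%E.
Proof.
move=> dF cf fi Fy FNy.
pose B n : set R := [set` `[- n%:R, n%:R]%R].
have mf : measurable_fun setT f by exact: continuous_measurable_fun.
have mF : measurable_fun setT (EFin \o f) by exact/measurable_EFinP.
have mB n : measurable_fun setT ((EFin \o f) \_ (B n)).
  apply/(measurable_restrictT _ _).1; first exact: measurable_itv.
  exact: measurable_funTS.
have cB : {ae leb, forall x, setT x -> ((EFin \o f) \_ (B n)) x @[n --> \oo] --> (EFin \o f) x}.
  apply: aeW => x _; apply: cvg_near_cst.
  near=> n; rewrite /= patchE mem_set//= /B/= in_itv/= -ler_norml.
  by near: n; exact: nbhs_infty_ger.
have dB : {ae leb, forall x n, setT x ->
    (`|((EFin \o f) \_ (B n)) x| <= `|(f x)%:E|)%E}.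
  by apply: aeW => x n _; rewrite patchE; case: ifPn => // _; rewrite abse0.
have [_ _ ] := @dominated_convergence _ _ R leb setT measurableT _ _ _ mB mF cB (integrable_abse fi) dB.
under eq_fun do rewrite -integral_mkcond /B (is_derive_integral _ dF cf) ?ge0_cp//.
move=> h1.
have h2 : (F n%:R - F (- n%:R))%:E @[n --> \oo] --> (0 - 0 : R)%:E.
  by apply: cvg_EFin; [exact: nearW | apply: cvgB].
rewrite subr0 in h2.
by rewrite (cvg_unique _ h1 h2).
Unshelve. all: by end_near. Qed.

End real_line_ftc.

Section integrable_bounded.
Context {R : realType}.

Lemma integrable_bounded_prob d (T : measurableType d) (P : probability T R) (f : T -> R) (M : R) :
  measurable_fun setT f -> (forall x, `|f x| <= M) ->
  P.-integrable setT (EFin \o f).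
Proof.
move=> mf fM; apply: measurable_bounded_integrable => //.
  by rewrite (le_lt_trans (probability_le1 P measurableT))// ltry.
by exists M; split => [|x /ltW Mx y _]; [exact: num_real | exact: le_trans Mx].
Qed.

Lemma norm_cos_le1 (x : R) : `|cos x| <= 1.
Proof. by rewrite ler_norml cos_geN1 cos_le1. Qed.

Lemma norm_sin_le1 (x : R) : `|sin x| <= 1.
Proof. by rewrite ler_norml sin_geN1 sin_le1. Qed.

Lemma measurable_cos : measurable_fun setT (@cos R).
Proof. by apply: continuous_measurable_fun; exact: continuous_cos. Qed.

Lemma measurable_sin : measurable_fun setT (@sin R).
Proof. by apply: continuous_measurable_fun; exact: continuous_sin. Qed.

Lemma measurable_cosM (a : R) : measurable_fun [set: measurableTypeR R] (fun x : R => cos (a * x)).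
Proof. by apply: (measurableT_comp measurable_cos); exact: mulrl_measurable. Qed.

Lemma measurable_sinM (a : R) : measurable_fun [set: measurableTypeR R] (fun x : R => sin (a * x)).
Proof. by apply: (measurableT_comp measurable_sin); exact: mulrl_measurable. Qed.

Lemma norm_le_expRDN (x : R) : `|x| <= expR x + expR (- x).
Proof.
have h1 := expR_ge1Dx x; have h2 := expR_ge1Dx (- x).
have h3 := expR_ge0 x; have h4 := expR_ge0 (- x).
by rewrite ler_norml; apply/andP; split; lra.
Qed.

Lemma sqr_le_expR (x : R) : x ^+ 2 <= 2 * (expR x + expR (- x)).
Proof.
have h0 := expR_ge0 x; have h1 := expR_ge0 (- x).
case: (lerP 0 x) => x0.
- have := expR_ge1Dxn 1 x0; rewrite (_ : 2`! = 2)%N// => h; lra.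
- have x0' : 0 <= - x by lra.
  have := expR_ge1Dxn 1 x0'; rewrite (_ : 2`! = 2)%N// sqrrN => h; lra.
Qed.

End integrable_bounded.

Section normal_charfun.
Context {R : realType}.
Variable s : R.
Hypothesis s0 : s != 0.
Local Notation leb := (@lebesgue_measure R).
Local Notation N := (normal_prob (0 : R) s).

Let mexp h : measurable_fun [set: measurableTypeR R] (fun x : R => expR (h * x)).
Proof. by apply: measurableT_comp => //; exact: mulrl_measurable. Qed.

Lemma integrable_normal_exp h :
  N.-integrable setT (fun x : measurableTypeR R => (expR (h * x))%:E).
Proof.
apply/integrableP; split; first exact/measurable_EFinP.
under eq_integral do rewrite /= ger0_norm ?expR_ge0//.
by rewrite normal_mgf// ltry.
Qed.

Lemma integrable_normal_id :
  N.-integrable setT (fun x : measurableTypeR R => x%:E).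
Proof.
have := integrableD measurableT (integrable_normal_exp 1) (integrable_normal_exp (-1)).
apply: le_integrable => //; first exact/measurable_EFinP.
move=> x _ /=; rewrite lee_fin mul1r mulN1r.
by rewrite [leRHS]ger0_norm ?addr_ge0 ?expR_ge0// norm_le_expRDN.
Qed.

Definition normal_cos (a : R) : R := \int[N]_x cos (a * (x : R)).

Let dcos (x a : R) : is_derive a 1 (fun b : R => cos (b * x)) (- (x * sin (a * x))).
Proof.
apply: trigger_derive; rewrite /GRing.scale/=; ring.
Qed.

Let cosM (b y : R) : R := cos (b * y).

Lemma is_derive_normal_cos (a : R) :
  is_derive a 1 normal_cos (- \int[N]_x ((x : R) * sin (a * x))).
Proof.
have Ia : [set` `]a - 1, a + 1[%R] a by rewrite /= in_itv/=; apply/andP; split; lra.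
have intf x : [set` `]a - 1, a + 1[%R] x -> N.-integrable setT (EFin \o cosM x).
  move=> _; apply: (@integrable_bounded_prob _ _ _ N _ 1) => [|y]; first exact: measurable_cosM.
  exact: norm_cos_le1.
have derf1 (x : R) (y : measurableTypeR R) : [set` `]a - 1, a + 1[%R] x -> setT y ->
    derivable (cosM ^~ y) x 1.
  by move=> _ _; exact: (@ex_derive _ _ _ _ _ _ _ (dcos y x)).
have d1E (x : R) (y : measurableTypeR R) : partial1of2 cosM x y = - ((y : R) * sin (x * y)).
  rewrite partial1of2E; exact: (@derive_val _ _ _ _ _ _ _ (dcos y x)).
have G0 (y : measurableTypeR R) : 0 <= `|y : R| by [].
have intG : N.-integrable setT (EFin \o (fun y : measurableTypeR R => `|y : R|)).
  by have := integrable_abse integrable_normal_id.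
have Gub (x : R) (y : measurableTypeR R) : [set` `]a - 1, a + 1[%R] x -> setT y ->
    `|partial1of2 cosM x y| <= `|y : R|.
  by move=> _ _; rewrite d1E normrN normrM ler_piMr// norm_sin_le1.
have dv := derivable_under_integral measurableT Ia intf derf1 G0 intG Gub.
have := differentiation_under_integral measurableT Ia intf derf1 G0 intG Gub.
rewrite derive1E => e; apply: DeriveDef => //.
rewrite [LHS]e.
under eq_Rintegral do rewrite d1E -mulN1r.
rewrite RintegralZl ?mulN1r//.
apply: le_integrable intG => //.
- apply/measurable_EFinP/measurable_funM => //; exact: measurable_sinM.
- move=> y _; rewrite lee_fin/= normr_id normrM ler_piMr//; exact: norm_sin_le1.
Qed.

Let pdf := normal_pdf (0 : R) s.

Let d_pdf (x : R) : is_derive x 1 pdf (- (x / s ^+ 2) * pdf x).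
Proof.
rewrite /pdf normal_pdfE// /normal_fun.
apply: trigger_derive; rewrite /GRing.scale/=.
have : s ^+ 2 != 0 by rewrite expf_neq0.
rewrite !subr0 -!(mulr_natr (s ^+ 2)); move: (s ^+ 2) => u u0.
set e := expR _; by field.
Qed.

Let pdf_le (x : R) : x != 0 -> pdf x <= normal_peak s * (2 * s ^+ 2 / x ^+ 2).
Proof.
move=> x0; rewrite /pdf normal_pdfE// ler_wpM2l ?normal_peak_ge0// /normal_fun subr0.
have s20 : 0 < s ^+ 2 by rewrite exprn_even_gt0.
have x20 : 0 < x ^+ 2 by rewrite exprn_even_gt0.
rewrite mulNr expRN -(mulr_natl (s ^+ 2)).
set u := x ^+ 2 / _.
have u0 : 0 < u by rewrite divr_gt0// mulr_gt0.
have -> : 2 * s ^+ 2 / x ^+ 2 = u^-1 by rewrite /u invf_div.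
by rewrite lef_pV2 ?posrE ?expR_gt0// (le_trans _ (expR_ge1Dx _))// lerDr.
Qed.

(** Stein's identity: the derivative of [g * pdf] is
    [(g' - x * g / s ^ 2) * pdf], and its integral over the line vanishes. *)
Lemma normal_stein (g g' : R -> R) :
  (forall x : R, is_derive x 1 g (g' x)) -> continuous g' ->
  (exists2 B, 0 <= B & forall x, `|g x| <= B * (1 + `|x|)) ->
  N.-integrable setT (EFin \o (fun x : measurableTypeR R => g' x)) ->
  N.-integrable setT (EFin \o (fun x : measurableTypeR R => (x : R) * g x)) ->
  \int[N]_x ((x : R) * g x) = s ^+ 2 * \int[N]_x g' x.
Proof.
move=> dg cg' [B B0 gB] ig' ixg.
have cg := is_derive_continuous dg.
have s20 : s ^+ 2 != 0 by rewrite expf_neq0.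
pose F x := g x * pdf x.
pose f x := g' x - (s ^+ 2)^-1 * (x * g x).
have dF (x : R) : is_derive x 1 F (f x * pdf x).
  apply: (is_derive_eq (is_deriveM (dg x) (d_pdf x))).
  by rewrite /f /GRing.scale/=; ring.
have cf : continuous f.
  move=> x; apply: cvgB; first exact: cg'.
  by apply: cvgM; [exact: cvg_cst|apply: cvgM; [exact: cvg_id|exact: cg]].
have ixg' : N.-integrable setT (EFin \o (fun x : measurableTypeR R => (s ^+ 2)^-1 * ((x : R) * g x))).
  by rewrite /comp; under eq_fun do rewrite EFinM; exact: integrableZl.
have i_f : N.-integrable setT (EFin \o (fun x : measurableTypeR R => f x)).
  by rewrite /f /comp; under eq_fun do rewrite EFinB; exact: integrableB.
have cfp : continuous (fun x => f x * pdf x).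
  by move=> x; apply: cvgM; [exact: cf|exact: continuous_normal_pdf].
have mf : measurable_fun [set: measurableTypeR R] (fun x : R => f x).
  exact: continuous_measurable_fun.
have ifp := integrable_normal_prob mf i_f.
have Fcvg (e : R) : `|e| = 1 -> F (e * n%:R) @[n --> \oo] --> (0 : R).
  move=> e1; rewrite -(cvg_shiftS (fun n => F (e * n%:R))); apply/norm_cvg0P.
  pose C := normal_peak s * (2 * s ^+ 2).
  have C0 : 0 <= C by rewrite mulr_ge0 ?normal_peak_ge0// mulr_ge0// sqr_ge0.
  have e2 : e ^+ 2 = 1 by rewrite -real_normK ?num_real// e1 expr1n.
  apply: (squeeze_cvgr (f := cst 0) (h := fun n => (2 * B * C) * harmonic n)).
  - apply: nearW => n /=; rewrite normr_ge0/= normrM (ger0_norm (normal_pdf_ge0 _ _ _)).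
    have en0 : e * n.+1%:R != 0 by rewrite mulf_neq0// -normr_eq0 e1 oner_eq0.
    have := gB (e * n.+1%:R); rewrite normrM e1 mul1r (ger0_norm (ler0n _ _)).
    have := pdf_le en0; rewrite exprMn e2 mul1r mulrA -/C => h1 h2.
    apply: (le_trans (ler_pM _ _ h2 h1)); rewrite ?normal_pdf_ge0//.
    have : 1 <= n.+1%:R :> R by rewrite ler1n.
    move: (n.+1%:R) => y y1.
    have -> : 2 * B * C / y = B * (2 * y) * (C / y ^+ 2) by field; rewrite gt_eqF//; lra.
    by rewrite ler_wpM2r ?divr_ge0 ?sqr_ge0// ler_wpM2l//; lra.
  - exact: cvg_cst.
  - by rewrite -[X in _ --> X](mulr0 (2 * B * C)); apply: cvgM; [exact: cvg_cst|exact: cvg_harmonic].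
have h0 : \int[N]_x f x = 0.
  rewrite /Rintegral integral_normal_prob//.
  have c1 : F n%:R @[n --> \oo] --> (0 : R).
    by under eq_fun do rewrite -[_%:R]mul1r; apply: Fcvg; rewrite normr1.
  have c2 : F (- n%:R) @[n --> \oo] --> (0 : R).
    by under eq_fun do rewrite -mulN1r; apply: Fcvg; rewrite normrN1.
  by have -> := is_derive_integralT0 dF cfp ifp c1 c2.
have : \int[N]_x f x = \int[N]_x g' x - (s ^+ 2)^-1 * \int[N]_x ((x : R) * g x).
  rewrite /f RintegralB//=.
  by rewrite (RintegralZl _ measurableT ixg).
rewrite h0 => /esym/eqP; rewrite subr_eq0 => /eqP ->.
by rewrite mulrA divff// mul1r.
Qed.

Let integrable_normal_cos a :
  N.-integrable setT (EFin \o (fun x : measurableTypeR R => cos (a * (x : R)))).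
Proof.
apply: (@integrable_bounded_prob _ _ _ N _ 1) => [|y]; first exact: measurable_cosM.
exact: norm_cos_le1.
Qed.

Let integrable_normal_xsin (a : R) :
  N.-integrable setT (EFin \o (fun x : measurableTypeR R => (x : R) * sin (a * (x : R)))).
Proof.
have intG : N.-integrable setT (EFin \o (fun y : measurableTypeR R => `|y : R|)).
  by have := integrable_abse integrable_normal_id.
apply: le_integrable intG => //.
- apply/measurable_EFinP/measurable_funM => //; exact: measurable_sinM.
- move=> y _; rewrite lee_fin/= normr_id normrM ler_piMr//; exact: norm_sin_le1.
Qed.

(** Stein's identity for [sin (a * x)]: the derivative of the characteristic
    function is [- a * s ^ 2] times itself. *)
Lemma normal_xsin (a : R) :
  \int[N]_x ((x : R) * sin (a * x)) = a * s ^+ 2 * normal_cos a.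
Proof.
have d_sin (x : R) : is_derive x 1 (fun y : R => sin (a * y)) (a * cos (a * x)).
  by apply: trigger_derive; rewrite /GRing.scale/=; ring.
have d_cos (x : R) : is_derive x 1 (fun y : R => cos (a * y)) (- (a * sin (a * x))).
  by apply: trigger_derive; rewrite /GRing.scale/=; ring.
have cc := is_derive_continuous d_cos.
rewrite (@normal_stein _ (fun x => a * cos (a * x)))//.
- rewrite (RintegralZl _ measurableT (integrable_normal_cos a)).
  by rewrite mulrCA mulrA.
- by move=> x; apply: cvgM; [exact: cvg_cst|exact: cc].
- exists 1 => // x; rewrite mul1r (le_trans (norm_sin_le1 _))//.
  by rewrite lerDl.
- rewrite /comp; under eq_fun do rewrite EFinM; apply: integrableZl => //.
  exact: integrable_normal_cos.
Qed.

Lemma integrable_normal_sqr :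
  N.-integrable setT (EFin \o (fun x : measurableTypeR R => (x : R) ^+ 2)).
Proof.
have := integrableD measurableT (integrable_normal_exp 1) (integrable_normal_exp (-1)).
move=> /(integrableZl measurableT 2); apply: le_integrable => //.
  by apply/measurable_EFinP; exact: measurable_funX.
move=> w _ /=; rewrite mul1r mulN1r lee_fin ger0_norm ?sqr_ge0//.
rewrite ger0_norm ?mulr_ge0 ?addr_ge0 ?expR_ge0//.
exact: sqr_le_expR.
Qed.

Lemma normal_sqr : \int[N]_x ((x : R) ^+ 2) = s ^+ 2.
Proof.
under eq_Rintegral do rewrite expr2.
rewrite (@normal_stein id (cst 1)).
- by rewrite Rintegral_cst// mul1r [X in fine X](_ : _ = 1%E) ?mulr1//; exact: integral_normal_pdf.
- by move=> x; exact: cvg_cst.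
- by exists 1 => // x; rewrite mul1r lerDr.
- exact: finite_measure_integrable_cst.
- exact: integrable_normal_sqr.
Qed.

(** The function [normal_cos b * exp (b ^ 2 * s ^ 2 / 2)] has zero derivative,
    by [is_derive_normal_cos] and [normal_xsin]. *)
Lemma normal_cosE (a : R) : normal_cos a = expR (- (a ^+ 2 * s ^+ 2 / 2)).
Proof.
pose u (b : R) := normal_cos b * expR (b ^+ 2 * s ^+ 2 / 2).
have du (b : R) : is_derive b 1 u 0.
  have d1 := is_derive_normal_cos b; rewrite normal_xsin in d1.
  have d2 : is_derive b 1 (fun b : R => expR (b ^+ 2 * s ^+ 2 / 2))
      (b * s ^+ 2 * expR (b ^+ 2 * s ^+ 2 / 2)).
    apply: trigger_derive; rewrite /GRing.scale/=.
    set E := expR _; by field.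
  apply: (is_derive_eq (is_deriveM d1 d2)).
  by rewrite /GRing.scale/=; ring.
have u0 : u 0 = 1.
  rewrite /u expr0n/= !mul0r expR0 mulr1 /normal_cos.
  under eq_Rintegral do rewrite mul0r cos0.
  rewrite Rintegral_cst// mul1r.
  by rewrite [X in fine X](_ : _ = 1%E)//; exact: integral_normal_pdf.
have : u a = 1 by rewrite (is_derive_0_is_cst a 0 du).
rewrite /u expRN => e.
have E0 : expR (a ^+ 2 * s ^+ 2 / 2) != 0 by rewrite gt_eqF// expR_gt0.
by apply: (mulIf E0); rewrite mulVf.
Qed.

End normal_charfun.

(** * Gaussian variables and their limits *)

Section convergence.
Context d (T : measurableType d) (R : realType).

Lemma dominated_cvg_Rintegral (mu : {measure set T -> \bar R}) (f_ : (T -> R)^nat) (f g : T -> R) :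
  (forall n, measurable_fun setT (f_ n)) -> (forall x, f_ n x @[n --> \oo] --> f x) ->
  mu.-integrable setT (EFin \o g) -> (forall n x, `|f_ n x| <= g x) ->
  \int[mu]_x f_ n x @[n --> \oo] --> \int[mu]_x f x.
Proof.
move=> mf_ cf ig fg.
have mf : measurable_fun setT f.
  by apply: (@measurable_fun_cvg _ _ _ _ f_ f) => // x _; exact: cf.
have m1 n : measurable_fun setT (EFin \o f_ n) by exact/measurable_EFinP.
have m2 : measurable_fun setT (EFin \o f) by exact/measurable_EFinP.
have c : {ae mu, forall x, setT x -> (EFin \o f_ n) x @[n --> \oo] --> (EFin \o f) x}.
  by apply: aeW => x _; apply: cvg_EFin; [exact: nearW|exact: cf].
have dm : {ae mu, forall x n, setT x -> (`|(EFin \o f_ n) x| <= (EFin \o g) x)%E}.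
  by apply: aeW => x n _; rewrite lee_fin.
have [i _ h] := @dominated_convergence _ _ R mu setT measurableT _ _ _ m1 m2 c ig dm.
apply: fine_cvg; rewrite fineK; first exact: h.
exact: integrable_fin_num.
Qed.

Lemma bounded_cvg_Rintegral (P : probability T R) (f_ : (T -> R)^nat) (f : T -> R) (M : R) :
  (forall n, measurable_fun setT (f_ n)) -> (forall x, f_ n x @[n --> \oo] --> f x) ->
  (forall n x, `|f_ n x| <= M) ->
  \int[P]_x f_ n x @[n --> \oo] --> \int[P]_x f x.
Proof.
move=> mf_ cf fM; apply: (@dominated_cvg_Rintegral _ _ _ (cst M)) => //.
exact: finite_measure_integrable_cst.
Qed.

End convergence.

Section law.
Context d (T : measurableType d) (R : realType) (P : probability T R).
Implicit Types (Z : T -> R) (m s h : R).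

Lemma ge0_integral_law Z (nu : {measure set (measurableTypeR R) -> \bar R}) :
  measurable_fun setT Z ->
  (forall A : set (measurableTypeR R), measurable A -> P (Z @^-1` A) = nu A) ->
  forall f : R -> \bar R, measurable_fun [set: measurableTypeR R] f ->
    (forall x, 0 <= f x)%E ->
  (\int[P]_w f (Z w) = \int[nu]_x f x)%E.
Proof.
move=> mZ PZ f mf f0.
have mZ' : measurable_fun setT (Z : T -> measurableTypeR R) by exact: mZ.
pose Zm := isMeasurableFun.Build _ _ _ _ _ mZ'.
pose Zp : {RV P >-> measurableTypeR R} := HB.pack (Z : T -> measurableTypeR R) Zm.
rewrite -(@ge0_integral_distribution _ _ _ _ _ P Zp f mf f0).
by apply: eq_measure_integral => A mA _; rewrite -PZ.
Qed.

Lemma integral_law Z (nu : {measure set (measurableTypeR R) -> \bar R}) :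
  measurable_fun setT Z ->
  (forall A : set (measurableTypeR R), measurable A -> P (Z @^-1` A) = nu A) ->
  forall f : R -> R, measurable_fun [set: measurableTypeR R] f ->
  (\int[P]_w (f (Z w))%:E = \int[nu]_x (f x)%:E)%E.
Proof.
move=> mZ PZ f mf; have mEf : measurable_fun [set: measurableTypeR R] (EFin \o f).
  exact/measurable_EFinP.
rewrite integralE [RHS]integralE; congr (_ - _)%E.
- rewrite -(ge0_integral_law mZ PZ)//; last exact: measurable_funepos.
  by apply: eq_integral => x _; rewrite !funeposE.
- rewrite -(ge0_integral_law mZ PZ)//; last exact: measurable_funeneg.
  by apply: eq_integral => x _; rewrite !funenegE.
Qed.

(** [gaussian_law] is a function of sets; changing variables in integrals
    needs it as a measure. *)
Lemma gaussian_rv_law Z : gaussian_rv P Z ->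
  exists m s (nu : {measure set (measurableTypeR R) -> \bar R}),
    [/\ forall A : set (measurableTypeR R), measurable A -> P (Z @^-1` A) = nu A,
        s = 0 -> forall A, nu A = \d_(m : measurableTypeR R) A &
        s != 0 -> forall A, nu A = normal_prob m s A].
Proof.
move=> [m [s h]]; exists m, s; move: h; rewrite /gaussian_law.
case: eqVneq => s0 h.
- by exists (\d_(m : measurableTypeR R)); split.
- by exists (normal_prob m s); split => // ss; rewrite ss eqxx in s0.
Qed.

Lemma gaussian_law_mgf Z m s (nu : {measure set (measurableTypeR R) -> \bar R}) :
  measurable_fun setT Z ->
  (forall A : set (measurableTypeR R), measurable A -> P (Z @^-1` A) = nu A) ->
  (s = 0 -> forall A, nu A = \d_(m : measurableTypeR R) A) ->
  (s != 0 -> forall A, nu A = normal_prob m s A) ->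
  forall h, (\int[P]_w (expR (h * Z w))%:E =
             (expR (h * m + h ^+ 2 * s ^+ 2 / 2))%:E)%E.
Proof.
move=> mZ PZ nu0 nu1 h.
have me : measurable_fun [set: measurableTypeR R] (fun x : R => expR (h * x)).
  by apply: measurableT_comp => //; exact: mulrl_measurable.
rewrite (integral_law mZ PZ me).
have [s0|s0] := eqVneq s 0.
- rewrite (@eq_measure_integral _ _ _ _ (\d_(m : measurableTypeR R)))//; last by move=> A _ _; rewrite nu0.
  rewrite integral_dirac//; last exact/measurable_EFinP.
  by rewrite diracT mul1e s0 expr0n/= mulr0 mul0r addr0.
- rewrite (@eq_measure_integral _ _ _ _ (normal_prob m s))//; last by move=> A _ _; rewrite nu1.
  by rewrite normal_mgf.
Qed.

Lemma gaussian_rv_mgf Z : measurable_fun setT Z -> gaussian_rv P Z ->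
  exists m s, forall h,
    (\int[P]_w (expR (h * Z w))%:E = (expR (h * m + h ^+ 2 * s ^+ 2 / 2))%:E)%E.
Proof.
move=> mZ /gaussian_rv_law[m [s [nu [PZ nu0 nu1]]]]; exists m, s.
exact: gaussian_law_mgf PZ nu0 nu1.
Qed.

End law.

(** Square integrability of a Gaussian variable comes from its moment
    generating function. *)
Section gaussian_moments.
Context d (T : measurableType d) (R : realType) (P : probability T R).
Variable Z : T -> R.
Hypotheses (mZ : measurable_fun setT Z) (gZ : gaussian_rv P Z).

Let integrable_expR_gaussian (h : R) :
  P.-integrable setT (fun w => (expR (h * Z w))%:E).
Proof.
have [m [s e]] := gaussian_rv_mgf mZ gZ.
apply/integrableP; split.
  by apply/measurable_EFinP; apply: measurableT_comp => //; exact: measurable_funM.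
under eq_integral do rewrite /= ger0_norm ?expR_ge0//.
by rewrite e ltry.
Qed.

Lemma gaussian_integrable_sqr : P.-integrable setT (fun w => (Z w ^+ 2)%:E).
Proof.
have := integrableD measurableT (integrable_expR_gaussian 1) (integrable_expR_gaussian (-1)).
move=> /(integrableZl measurableT 2); apply: le_integrable => //.
  by apply/measurable_EFinP; exact: measurable_funX.
move=> w _ /=; rewrite mul1r mulN1r lee_fin ger0_norm ?sqr_ge0//.
rewrite ger0_norm ?mulr_ge0 ?addr_ge0 ?expR_ge0//.
exact: sqr_le_expR.
Qed.

Lemma gaussian_integrable : P.-integrable setT (EFin \o Z).
Proof.
have := integrableD measurableT (integrable_expR_gaussian 1) (integrable_expR_gaussian (-1)).
apply: le_integrable => //; first exact/measurable_EFinP.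
move=> w _ /=; rewrite mul1r mulN1r lee_fin.
by rewrite [leRHS]ger0_norm ?addr_ge0 ?expR_ge0// norm_le_expRDN.
Qed.

(** A centred Gaussian variable has [1 <= E exp (h Z)] for all [h], which
    forces the location parameter of its law to vanish. *)
Lemma gaussian_location0 (m s : R) : (\int[P]_w (Z w)%:E = 0)%E ->
  (forall h, \int[P]_w (expR (h * Z w))%:E = (expR (h * m + h ^+ 2 * s ^+ 2 / 2))%:E)%E ->
  m = 0.
Proof.
move=> EZ mgf.
have ge1 h : 0 <= h * m + h ^+ 2 * s ^+ 2 / 2.
  have hZ : P.-integrable setT (fun w => (h%:E * (Z w)%:E)%E).
    by apply: integrableZl => //; exact: gaussian_integrable.
  have : (\int[P]_w (1%:E + h%:E * (Z w)%:E) <= \int[P]_w (expR (h * Z w))%:E)%E.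
    apply: le_integral => //.
    - by apply: integrableD => //; exact: finite_measure_integrable_cst.
    - by move=> w _; rewrite -EFinM -EFinD lee_fin expR_ge1Dx.
  rewrite integralD//; last exact: finite_measure_integrable_cst.
  rewrite integral_cst// [X in (_ * X)%E](_ : _ = 1%E); last exact: probability_setT.
  rewrite mul1e integralZl//; last exact: gaussian_integrable.
  by rewrite EZ mule0 adde0 mgf lee_fin -[leLHS]expR0 ler_expR.
apply: contrapT => /eqP m0.
have D0 : 0 < s ^+ 2 + 1 by rewrite ltr_wpDl// sqr_ge0.
have := ge1 (- m / (s ^+ 2 + 1)).
have -> : - m / (s ^+ 2 + 1) * m + (- m / (s ^+ 2 + 1)) ^+ 2 * s ^+ 2 / 2 =
  - (m ^+ 2 / (s ^+ 2 + 1) ^+ 2 * (s ^+ 2 / 2 + 1)).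
  by field; rewrite gt_eqF.
have m20 : 0 < m ^+ 2 by rewrite exprn_even_gt0.
rewrite leNgt oppr_lt0 mulr_gt0// ?divr_gt0// ?exprn_gt0//.
by rewrite ltr_wpDl// mulr_ge0 ?sqr_ge0.
Qed.

Variable v : R.
Hypotheses (EZ : (\int[P]_w (Z w)%:E = 0)%E) (EZ2 : (\int[P]_w (Z w ^+ 2)%:E = v%:E)%E).

Let centered_law : exists s (nu : {measure set (measurableTypeR R) -> \bar R}),
    [/\ v = s ^+ 2,
        forall A : set (measurableTypeR R), measurable A -> P (Z @^-1` A) = nu A,
        s = 0 -> forall A, nu A = \d_(0 : measurableTypeR R) A &
        s != 0 -> forall A, nu A = normal_prob (0 : R) s A].
Proof.
have [m [s [nu [PZ nu0 nu1]]]] := gaussian_rv_law gZ.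
have m0 : m = 0 by apply: (gaussian_location0 (s := s)) => // h; exact: gaussian_law_mgf PZ nu0 nu1 h.
subst m; exists s, nu; split => //.
have msq : measurable_fun [set: measurableTypeR R] (fun x : R => x ^+ 2) by exact: measurable_funX.
move: EZ2; rewrite (integral_law mZ PZ msq).
have [s0|s0] := eqVneq s 0.
- rewrite (@eq_measure_integral _ _ _ _ (\d_(0 : measurableTypeR R)))//; last by move=> A _ _; rewrite nu0.
  rewrite integral_dirac//; last exact/measurable_EFinP.
  by rewrite diracT mul1e expr0n/= => -[<-]; rewrite s0 expr0n.
- rewrite (@eq_measure_integral _ _ _ _ (normal_prob 0 s))//; last by move=> A _ _; rewrite nu1.
  rewrite -(normal_sqr s0) => /(congr1 fine) /= <-.
  by [].
Qed.

Lemma gaussian_cos (a : R) : \int[P]_w cos (a * Z w) = expR (- (a ^+ 2 * v / 2)).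
Proof.
have [s [nu [-> PZ nu0 nu1]]] := centered_law.
rewrite /Rintegral (integral_law mZ PZ (measurable_cosM a)).
have [s0|s0] := eqVneq s 0.
- rewrite (@eq_measure_integral _ _ _ _ (\d_(0 : measurableTypeR R)))//; last by move=> A _ _; rewrite nu0.
  rewrite integral_dirac//; last by apply/measurable_EFinP; exact: measurable_cosM.
  by rewrite diracT mul1e s0 expr0n/= !mulr0 cos0 mul0r oppr0 expR0.
- rewrite (@eq_measure_integral _ _ _ _ (normal_prob 0 s))//; last by move=> A _ _; rewrite nu1.
  exact: normal_cosE.
Qed.

(** The integral is [1] for a Dirac mass; otherwise the integrand decreases with
    [q], and [normal_exp_sqr] gives the case [q = v]. *)
Lemma gaussian_exp_sqr (q : R) : 0 < q -> v <= q ->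
  (\int[P]_w (expR (Z w ^+ 2 / (4 * q)))%:E <= (Num.sqrt 2)%:E)%E.
Proof.
move=> q0; have [s [nu [-> PZ nu0 nu1]]] := centered_law => sq.
have me (c : R) : measurable_fun [set: measurableTypeR R] (fun x : R => expR (x ^+ 2 / c)).
  by apply: measurableT_comp => //; apply: measurable_funM => //; exact: measurable_funX.
rewrite (integral_law mZ PZ (me _)).
have [s0|s0] := eqVneq s 0.
- rewrite (@eq_measure_integral _ _ _ _ (\d_(0 : measurableTypeR R)))//; last by move=> A _ _; rewrite nu0.
  rewrite integral_dirac//; last exact/measurable_EFinP.
  rewrite diracT mul1e expr0n/= mul0r expR0 lee_fin.
  by rewrite -[leLHS]sqrtr1 ler_sqrt// ler1n.
- rewrite (@eq_measure_integral _ _ _ _ (normal_prob 0 s))//; last by move=> A _ _; rewrite nu1.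
  rewrite -(normal_exp_sqr s0); apply: ge0_le_integral => //.
  + exact/measurable_EFinP.
  + exact/measurable_EFinP.
  + move=> x _; rewrite lee_fin ler_expR ler_wpM2l ?sqr_ge0//.
    by rewrite lef_pV2 ?posrE ?(mulr_gt0 (_ : 0 < 4)) ?exprn_even_gt0// ler_pM2l.
Qed.

End gaussian_moments.

(** Variables whose characteristic function is that of [N(0, q)], and whose
    exponential square moments are bounded as those of [N(0, q)].  Unlike
    [gaussian_rv], this is easily seen to be stable under pointwise limits. *)
Section normal_like.
Context d (T : measurableType d) (R : realType) (P : probability T R).
Implicit Types (Z : T -> R) (q a : R).

Definition normal_like q Z : Prop :=
  [/\ measurable_fun setT Z,
      forall a, \int[P]_w cos (a * Z w) = expR (- (a ^+ 2 * q / 2)) &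
      forall q', 0 < q' -> q < q' ->
        (\int[P]_w (expR (Z w ^+ 2 / (4 * q')))%:E <= (Num.sqrt 2)%:E)%E].

(** Bounded convergence for the characteristic function, Fatou's lemma for the
    exponential square moments; the strict inequality [q < q'] in the
    definition leaves room for the variances of the approximations. *)
Lemma normal_like_lim (q_ : R^nat) (Z_ : (T -> R)^nat) q Z :
  (forall n, normal_like (q_ n) (Z_ n)) ->
  q_ n @[n --> \oo] --> q -> (forall w, Z_ n w @[n --> \oo] --> Z w) ->
  normal_like q Z.
Proof.
move=> nZ cq cZ.
have mZ_ n : measurable_fun setT (Z_ n) by case: (nZ n).
have mZ : measurable_fun setT Z.
  by apply: (@measurable_fun_cvg _ _ _ _ Z_ Z) => // w _; exact: cZ.
split => // [a|q' q'0 qq'].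
- have mcos (Y : T -> R) : measurable_fun setT Y -> measurable_fun setT (fun w => cos (a * Y w)).
    by move=> mY; apply: (measurableT_comp measurable_cos); exact: measurable_funM.
  have c1 : \int[P]_w cos (a * Z_ n w) @[n --> \oo] --> \int[P]_w cos (a * Z w).
    apply: (@bounded_cvg_Rintegral _ _ _ _ _ _ 1) => // [n|w|n w].
    + exact: mcos.
    + apply: continuous_cvg; first exact: continuous_cos.
      by apply: cvgM; [exact: cvg_cst|exact: cZ].
    + exact: norm_cos_le1.
  have c2 : \int[P]_w cos (a * Z_ n w) @[n --> \oo] --> expR (- (a ^+ 2 * q / 2)).
    have e n : \int[P]_w cos (a * Z_ n w) = expR (- (a ^+ 2 * q_ n / 2)) by case: (nZ n).
    under eq_fun do rewrite e.
    apply: continuous_cvg; [exact: continuous_expR|apply: cvgN].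
    apply: cvgM; last exact: cvg_cst.
    by apply: cvgM; [exact: cvg_cst|exact: cq].
  exact: (cvg_unique _ c1 c2).
- have mexp (Y : T -> R) : measurable_fun setT Y ->
      measurable_fun setT (fun w => (expR (Y w ^+ 2 / (4 * q')))%:E).
    move=> mY; apply/measurable_EFinP; apply: measurableT_comp => //.
    by apply: measurable_funM => //; exact: measurable_funX.
  have e0 (Y : T -> R) w : (0 <= (expR (Y w ^+ 2 / (4 * q')))%:E)%E.
    by rewrite lee_fin expR_ge0.
  have ec w : (expR (Z_ n w ^+ 2 / (4 * q')))%:E @[n --> \oo] --> (expR (Z w ^+ 2 / (4 * q')))%:E.
    apply: cvg_EFin; first exact: nearW.
    apply: continuous_cvg; first exact: continuous_expR.
    apply: cvgM; last exact: cvg_cst.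
    by under eq_fun do rewrite expr2; rewrite expr2; apply: cvgM; exact: cZ.
  rewrite (eq_integral (fun w => limn_einf (fun n => (expR (Z_ n w ^+ 2 / (4 * q')))%:E))); last first.
    move=> w _; rewrite is_cvg_limn_einfE; first by apply/esym/cvg_lim => //; exact: ec.
    by apply/cvg_ex; eexists; exact: ec.
  apply: (le_trans (fatou _ _ _ _)) => //.
    by move=> n; exact: mexp.
  rewrite limn_einf_lim; apply: lime_le; first exact: is_cvg_einfs.
  near=> n; apply: ge_ereal_inf.
  exists (\int[P]_w (expR (Z_ n w ^+ 2 / (4 * q')))%:E)%E; first by exists n => /=.
  case: (nZ n) => _ _; apply => //.
  near: n; exact: (cvgr_lt q).
Unshelve. all: by end_near. Qed.

End normal_like.

(** * Derivatives of the sample paths *)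

Section jets.
Context {R : realType}.
Implicit Types (E : nat -> R -> R) (J n : nat) (l : seq (R * nat * R)).

(** A triple [(a, j, t)] stands for [a * E j t], where [E j] is the derivative of
    order [j]. Lists of triples let one derivative be traded for the two terms
    of a difference quotient. *)
Definition jet_comb (l : seq (R * nat * R)) (E : nat -> R -> R) : R :=
  \sum_(p <- l) p.1.1 * E p.1.2 p.2.

(** The derivatives of order [J.+1] replaced by difference quotients of those
    of order [J], with step [1 / n.+1]. *)
Definition jet_quotient (J n : nat) (p : R * nat * R) : seq (R * nat * R) :=
  if p.1.2 == J.+1 then
    [:: (p.1.1 * n.+1%:R, J, p.2 + n.+1%:R^-1); (- (p.1.1 * n.+1%:R), J, p.2)]
  else [:: p].

Definition jet_quotients J n l := flatten [seq jet_quotient J n p | p <- l].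

Lemma jet_quotients_order J n l :
  all (fun p => p.1.2 <= J.+1)%N l -> all (fun p => p.1.2 <= J)%N (jet_quotients J n l).
Proof.
move=> /allP lJ; apply/allP => q /flatten_mapP[p pl].
rewrite /jet_quotient; case: eqP => pJ; rewrite !inE.
- by case/orP => /eqP ->.
- by move=> /eqP ->; have := lJ _ pl; rewrite leq_eqVlt => /orP[/eqP|].
Qed.

Lemma jet_comb_quotients J n l E :
  jet_comb (jet_quotients J n l) E =
  \sum_(p <- l) p.1.1 * (if p.1.2 == J.+1
     then n.+1%:R * (E J (p.2 + n.+1%:R^-1) - E J p.2) else E p.1.2 p.2).
Proof.
rewrite /jet_comb /jet_quotients big_flatten big_map; apply: eq_bigr => p _.
rewrite /jet_quotient; case: eqP => _; last by rewrite big_seq1.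
by rewrite big_cons big_seq1/=; ring.
Qed.

Lemma cvg_sum_seq (I : Type) (l : seq I) (f : nat -> I -> R) (g : I -> R) :
  (forall i, f n i @[n --> \oo] --> g i) ->
  (\sum_(i <- l) f n i) @[n --> \oo] --> \sum_(i <- l) g i.
Proof.
move=> fg; elim: l => [|i l ih].
  by under eq_fun do rewrite big_nil; rewrite big_nil; exact: cvg_cst.
under eq_fun do rewrite big_cons; rewrite big_cons; exact: cvgD.
Qed.

Lemma cvg_jet_quotients J l E :
  (forall j t, n.+1%:R * (E j (t + n.+1%:R^-1) - E j t) @[n --> \oo] --> E j.+1 t) ->
  jet_comb (jet_quotients J n l) E @[n --> \oo] --> jet_comb l E.
Proof.
move=> dE; under eq_fun do rewrite jet_comb_quotients.
apply: cvg_sum_seq => p; apply: cvgM; first exact: cvg_cst.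
by case: eqP => [->|_]; [exact: dE|exact: cvg_cst].
Qed.

Lemma jet_quotients_bound J n l E (B : nat -> R) :
  (forall j t, `|E j t| <= B j) ->
  (forall j t h, 0 < h -> `|E j (t + h) - E j t| <= h * B j.+1) ->
  `|jet_comb (jet_quotients J n l) E| <= \sum_(p <- l) `|p.1.1| * B p.1.2.
Proof.
move=> EB dEB; rewrite jet_comb_quotients.
apply: (le_trans (ler_norm_sum _ _ _)); apply: ler_sum => p _.
rewrite normrM ler_wpM2l//; case: eqP => [->|_]; last exact: EB.
rewrite normrM (ger0_norm (ler0n _ _)) -ler_pdivlMl ?ltr0Sn//.
by apply: dEB; rewrite invr_gt0.
Qed.

Lemma cvg_difference_quotient (f : R -> R) (x : R) : derivable f x 1 ->
  n.+1%:R * (f (x + n.+1%:R^-1) - f x) @[n --> \oo] --> derive1 f x.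
Proof.
move=> df; rewrite derive1E /derive.
have h0 : (forall n, @harmonic R n != 0) /\ @harmonic R n @[n --> \oo] --> (0 : R).
  by split => [n|]; [rewrite gt_eqF// harmonic_gt0|exact: cvg_harmonic].
have := (cvgr_dnbhsP _ _ _).1 df _ h0.
apply: cvg_trans; apply: near_eq_cvg; apply: nearW => n /=.
by rewrite invrK /GRing.scale/= mulr1 (addrC x).
Qed.

Lemma cvg_quotient_is_derive (f : R -> R) (x df : R) : is_derive x 1 f df ->
  n.+1%:R * (f (x + n.+1%:R^-1) - f x) @[n --> \oo] --> df.
Proof.
move=> d; rewrite -(@derive_val _ _ _ _ _ _ _ d) -derive1E.
exact: cvg_difference_quotient (@ex_derive _ _ _ _ _ _ _ d).
Qed.

(** Real and imaginary parts of [(i x) ^ j * exp (i t x)], which is the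
    derivative of order [j] in [t] of [exp (i t x)]. *)
Fixpoint dcs (j : nat) (x t : R) : R * R :=
  if j is j'.+1 then (- (x * (dcs j' x t).2), x * (dcs j' x t).1)
  else (cos (t * x), sin (t * x)).

Lemma is_derive_dcs j (x t : R) :
  is_derive t 1 (fun t => (dcs j x t).1) (dcs j.+1 x t).1 /\
  is_derive t 1 (fun t => (dcs j x t).2) (dcs j.+1 x t).2.
Proof.
elim: j => [|j [ih1 ih2]]; split; rewrite /=.
- by apply: trigger_derive; rewrite /GRing.scale/=; ring.
- by apply: trigger_derive; rewrite /GRing.scale/=; ring.
- apply: (is_derive_eq (is_deriveN (is_deriveZ x ih2))).
  by rewrite /GRing.scale/=; ring.
- apply: (is_derive_eq (is_deriveZ x ih1)).
  by rewrite /GRing.scale/=; ring.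
Qed.

Lemma dcs_sqr j (x t : R) :
  (dcs j x t).1 ^+ 2 + (dcs j x t).2 ^+ 2 = x ^+ j ^+ 2.
Proof.
elim: j => [|j ih] /=; first by rewrite cos2Dsin2 expr0 expr1n.
transitivity (x ^+ 2 * x ^+ j ^+ 2); first by rewrite -ih; ring.
by rewrite -exprMn -exprS.
Qed.

Lemma norm_dcs j (x t : R) :
  `|(dcs j x t).1| <= `|x| ^+ j /\ `|(dcs j x t).2| <= `|x| ^+ j.
Proof.
have := dcs_sqr j x t; rewrite -normrX => h.
have le_norm (u v : R) : u ^+ 2 <= v ^+ 2 -> `|u| <= `|v|.
  by move=> uv; rewrite -(ler_pXn2r (ltn0Sn 1)) ?nnegrE// -!normrX !ger0_norm ?sqr_ge0.
by split; apply: le_norm; rewrite -h ?lerDl ?lerDr sqr_ge0.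
Qed.

Lemma measurable_dcs j (t : R) :
  measurable_fun [set: measurableTypeR R] (fun x : R => (dcs j x t).1) /\
  measurable_fun [set: measurableTypeR R] (fun x : R => (dcs j x t).2).
Proof.
elim: j => [|j [ih1 ih2]] /=.
  by split; [exact: measurable_cosM|exact: measurable_sinM].
split; last exact: measurable_funM.
by apply: measurableT_comp => //; exact: measurable_funM.
Qed.

Lemma mvt_increment (f f' : R -> R) (B : R) (t h : R) : 0 < h ->
  (forall x : R, is_derive x 1 f (f' x)) -> (forall x, `|f' x| <= B) ->
  `|f (t + h) - f t| <= h * B.
Proof.
move=> h0 df fB.
have cf := is_derive_continuous df.
have tth : t < t + h by rewrite ltrDl.
have [c _ ->] := @MVT R f f' t (t + h) tth (fun x _ => df x) (continuous_subspaceT cf).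
by rewrite addrC addKr normrM (gtr0_norm h0) mulrC ler_wpM2l// ltW.
Qed.

End jets.

Section integrals_of_sums.
Context d (S : measurableType d) (R : realType) (m : {measure set S -> \bar R}).

Lemma integrable_product (Y Z : S -> R) :
  measurable_fun setT Y -> measurable_fun setT Z ->
  m.-integrable setT (fun w => (Y w ^+ 2)%:E) ->
  m.-integrable setT (fun w => (Z w ^+ 2)%:E) ->
  m.-integrable setT (EFin \o (fun w => Y w * Z w)).
Proof.
move=> mY mZ iY iZ; have := integrableD measurableT iY iZ.
apply: le_integrable => //; first by apply/measurable_EFinP; exact: measurable_funM.
move=> w _; rewrite lee_fin [leRHS]ger0_norm ?addr_ge0 ?sqr_ge0//.
rewrite ler_norml; apply/andP; split; nra.
Qed.

Lemma Rintegral_sum (I : Type)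
    (r : seq I) (f : I -> S -> R) :
  (forall i, m.-integrable setT (EFin \o f i)) ->
  \int[m]_x (\sum_(i <- r) f i x) = \sum_(i <- r) \int[m]_x f i x.
Proof.
move=> fi; elim: r => [|i r ih].
  by rewrite big_nil; under eq_Rintegral do rewrite big_nil; rewrite /Rintegral integral0.
under eq_Rintegral do rewrite big_cons; rewrite big_cons RintegralD ?ih//.
have := integrable_sum measurableT r (P := xpredT) (fun i _ => fi i).
by apply: eq_integrable => // x _; rewrite sumEFin.
Qed.

Lemma integrable_sumR (I : Type)
    (r : seq I) (f : I -> S -> R) :
  (forall i, m.-integrable setT (EFin \o f i)) ->
  m.-integrable setT (EFin \o (fun x => \sum_(i <- r) f i x)).
Proof.
move=> fi; have := integrable_sum measurableT r (P := xpredT) (fun i _ => fi i).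
by apply: eq_integrable => // x _; rewrite /= sumEFin.
Qed.

Lemma sqr_sum (I : Type) (r : seq I) (f : I -> R) :
  (\sum_(i <- r) f i) ^+ 2 = \sum_(i <- r) \sum_(k <- r) f i * f k.
Proof.
rewrite expr2 mulr_suml; apply: eq_bigr => i _; rewrite mulr_sumr.
by apply: eq_bigr => k _.
Qed.

End integrals_of_sums.

Section process.
Context (R : realType) (d : measure_display) (T : measurableType d)
  (P : probability T R) (X : R -> {RV P >-> R}).
Variable mu : probability (measurableTypeR R) R.
Hypotheses (X_gaussian : gaussian_process X) (X_centered : centered X)
  (X_stationary : stationary X) (X_smooth : smooth_paths X)
  (X_mu : is_spectral_measure X mu) (mu_moments : finite_moments mu).
Implicit Types (J n : nat) (l : seq (R * nat * R)).

Definition path_derive (w : T) (j : nat) (t : R) : R :=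
  derive1n j (fun y : R => X y w : R^o) t.

(** Squared modulus of the sum of the [a * (i x) ^ j * exp (i t x)], the
    spectral density of the combination of derivatives with respect to [mu]. *)
Definition jet_symbol l (x : R) : R :=
  (jet_comb l (fun j t => (dcs j x t).1)) ^+ 2 +
  (jet_comb l (fun j t => (dcs j x t).2)) ^+ 2.

Definition jet_variance l : R := \int[mu]_x jet_symbol l x.

Let gaussX t : gaussian_rv P (X t).
Proof.
have := X_gaussian (fun _ : 'I_1 => t) (fun => 1).
by congr gaussian_rv; apply/funext => w; rewrite big_ord1 mul1r.
Qed.

Let mX t : measurable_fun setT (X t). Proof. exact: measurable_funPT. Qed.

Let integrable_XX t s : P.-integrable setT (EFin \o (fun w => X t w * X s w)).
Proof. by apply: integrable_product => //; apply: gaussian_integrable_sqr. Qed.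

(** Stationarity, for the pair of times [(t - s, 0)] shifted by [s]. *)
Lemma covariance_shift t s :
  \int[P]_w (X t w * X s w) = \int[P]_w (X (t - s) w * X 0 w).
Proof.
have mXX u v : measurable_fun setT (fun w => X u w * X v w) by exact: measurable_funM.
have mXX' u v : measurable_fun setT (fun w => X u w * X v w : measurableTypeR R) by exact: mXX.
pose Zm := isMeasurableFun.Build _ _ _ _ _ (mXX' (t - s) 0).
pose Zp : {RV P >-> measurableTypeR R} := HB.pack (fun w => X (t - s) w * X 0 w : measurableTypeR R) Zm.
pose B A := [set v : 2.-tuple (measurableTypeR R) | A ((tnth v ord0 : R) * tnth v (lift ord0 ord0))].
have mB A : measurable A -> measurable (B A).
  move=> mA; pose g (v : 2.-tuple (measurableTypeR R)) : R := (tnth v ord0 : R) * tnth v (lift ord0 ord0).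
  have mg : measurable_fun setT g by apply: measurable_funM; exact: measurable_tnth.
  by have := mg measurableT A mA; rewrite setTI.
have BE (u v h : R) A : [set w | B A [tuple X (tnth [tuple u; v] i + h) w | i < 2]] =
    (fun w => X (u + h) w * X (v + h) w) @^-1` A.
  by apply/seteqP; split => w; rewrite /B /= !tnth_mktuple !(tnth_nth 0).
have BE0 (u v : R) A : [set w | B A [tuple X (tnth [tuple u; v] i) w | i < 2]] =
    (fun w => X u w * X v w) @^-1` A.
  by apply/seteqP; split => w; rewrite /B /= !tnth_mktuple !(tnth_nth 0).
have lawE A : measurable A -> P ((fun w => X t w * X s w) @^-1` A) = distribution P Zp A.
  move=> mA; have := X_stationary [tuple t - s; 0] s (mB _ mA).
  by rewrite BE BE0 subrK add0r.
have mid : measurable_fun [set: measurableTypeR R] (id : R -> R) by exact: measurable_id.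
have lawE' A : measurable A -> P ((fun w => X (t - s) w * X 0 w) @^-1` A) = distribution P Zp A by [].
have e1 := integral_law (mXX t s) lawE mid; have e2 := integral_law (mXX (t - s) 0) lawE' mid.
by rewrite /Rintegral; congr fine; exact: etrans e1 (esym e2).
Qed.

Lemma covarianceE t s : \int[P]_w (X t w * X s w) = \int[mu]_x cos ((t - s) * x).
Proof.
rewrite covariance_shift; have [h _] := X_mu (t - s).
move: h; rewrite unlock /Rintegral => ->.
by congr fine; apply: eq_integral => x _; rewrite cosN.
Qed.

Let XcombE l w : all (fun p => p.1.2 <= 0)%N l ->
  jet_comb l (path_derive w) = \sum_(p <- l) p.1.1 * X p.2 w.
Proof.
move=> /allP l0; apply: eq_big_seq => p /l0; rewrite leqn0 => /eqP ->.
by rewrite /path_derive /= .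
Qed.

Lemma second_moment0 l : all (fun p => p.1.2 <= 0)%N l ->
  \int[P]_w (jet_comb l (path_derive w)) ^+ 2 = jet_variance l.
Proof.
move=> l0.
have iP p q : P.-integrable setT (EFin \o (fun w => (p.1.1 * X p.2 w) * (q.1.1 * X q.2 w))).
  have := integrableZl measurableT (p.1.1 * q.1.1) (integrable_XX p.2 q.2).
  by apply: eq_integrable => // w _ /=; congr EFin; ring.
have imu p q : mu.-integrable setT (EFin \o (fun x : measurableTypeR R => (p.1.1 * q.1.1) * cos ((p.2 - q.2) * (x : R)))).
  rewrite /comp; under eq_fun do rewrite EFinM; apply: integrableZl => //.
  apply: (@integrable_bounded_prob _ _ _ mu _ 1) => [|x]; first exact: measurable_cosM.
  exact: norm_cos_le1.
transitivity (\sum_(p <- l) \sum_(q <- l) (p.1.1 * q.1.1) * \int[mu]_x cos ((p.2 - q.2) * x)).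
  under eq_Rintegral do rewrite XcombE// sqr_sum.
  rewrite Rintegral_sum => [|p]; last exact: integrable_sumR.
  apply: eq_bigr => p _; rewrite Rintegral_sum//; apply: eq_bigr => q _.
  rewrite -covarianceE -(RintegralZl _ measurableT (integrable_XX _ _)).
  by apply: eq_Rintegral => w _; ring.
rewrite /jet_variance /jet_symbol.
transitivity (\int[mu]_x \sum_(p <- l) \sum_(q <- l) (p.1.1 * q.1.1) * cos ((p.2 - q.2) * x)).
  rewrite Rintegral_sum => [|p]; last exact: integrable_sumR.
  apply: eq_bigr => p _; rewrite Rintegral_sum//; apply: eq_bigr => q _.
  rewrite RintegralZl//.
  apply: (@integrable_bounded_prob _ _ _ mu _ 1) => [|x]; first exact: measurable_cosM.
  exact: norm_cos_le1.
apply: eq_Rintegral => x _; rewrite /jet_comb !sqr_sum -big_split/=.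
apply: eq_big_seq => p pl; rewrite -big_split/=; apply: eq_big_seq => q ql.
move/allP : l0 => l0.
have /eqP -> : p.1.2 == 0%N by rewrite -leqn0 l0.
have /eqP -> : q.1.2 == 0%N by rewrite -leqn0 l0.
by rewrite /= mulrBl cosB; ring.
Qed.

Lemma normal_like_jet0 l : all (fun p => p.1.2 <= 0)%N l ->
  normal_like P (jet_variance l) (fun w => jet_comb l (path_derive w)).
Proof.
move=> l0; set Z := fun w => _.
have ZE : Z = fun w => \sum_(p <- l) p.1.1 * X p.2 w by apply/funext => w; exact: XcombE.
have mZ : measurable_fun setT Z.
  by rewrite ZE; apply: measurable_sum => p; exact: measurable_funM.
have gZ : gaussian_rv P Z.
  rewrite (_ : Z = fun w => \sum_(i < size l)
    (tnth (in_tuple l) i).1.1 * X (tnth (in_tuple l) i).2 w); first exact: X_gaussian.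
  by rewrite ZE; apply/funext => w; rewrite big_tnth.
have EZ : (\int[P]_w (Z w)%:E = 0)%E.
  have iX p : P.-integrable setT (fun w => (p.1.1 * X p.2 w)%:E).
    under eq_fun do rewrite EFinM; apply: integrableZl => //.
    exact: gaussian_integrable.
  rewrite ZE; under eq_integral do rewrite -sumEFin.
  rewrite integral_sum//; rewrite big1// => p _.
  under eq_integral do rewrite EFinM.
  rewrite integralZl//; last exact: gaussian_integrable.
  have := X_centered p.2; rewrite unlock => ->; exact: mule0.
have iZ2 := gaussian_integrable_sqr mZ gZ.
have EZ2 : (\int[P]_w (Z w ^+ 2)%:E = (jet_variance l)%:E)%E.
  by rewrite -second_moment0// /Rintegral fineK//; exact: integrable_fin_num.
split => // [a|q q0 vq].
- have h := gaussian_cos mZ gZ EZ EZ2 a; exact h.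
- have h := gaussian_exp_sqr mZ gZ EZ EZ2 q0 (ltW vq); exact h.
Qed.

Lemma measurable_jet_symbol l :
  measurable_fun [set: measurableTypeR R] (fun x : R => jet_symbol l x).
Proof.
apply: measurable_funD; apply: measurable_funX; apply: measurable_sum => p;
  apply: measurable_funM => //; by case: (measurable_dcs p.1.2 p.2).
Qed.

Let bound l (x : R) : R := \sum_(p <- l) `|p.1.1| * `|x| ^+ p.1.2.

Let bound_ge0 l x : 0 <= bound l x.
Proof. by apply: sumr_ge0 => p _; rewrite mulr_ge0 ?exprn_ge0. Qed.

Let integrable_bound l :
  mu.-integrable setT (EFin \o (fun x : measurableTypeR R => 2 * bound l x ^+ 2)).
Proof.
rewrite /comp; under eq_fun do rewrite EFinM; apply: integrableZl => //.
rewrite /bound; under eq_fun do rewrite sqr_sum.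
apply: integrable_sumR => p; apply: integrable_sumR => q.
have := integrableZl measurableT (`|p.1.1| * `|q.1.1|) (mu_moments (p.1.2 + q.1.2)).
by apply: eq_integrable => // x _ /=; congr EFin; rewrite exprD; ring.
Qed.

(** By the mean value theorem, a difference quotient of [exp (i t x)] is
    bounded by the supremum of the next derivative, uniformly in the step. *)
Let jet_symbol_quotients_bound J n l (x : R) :
  `|jet_symbol (jet_quotients J n l) x| <= 2 * bound l x ^+ 2.
Proof.
rewrite ger0_norm ?addr_ge0 ?sqr_ge0// mulr_natl mulr2n.
apply: lerD; rewrite -real_normK ?num_real// ler_pXn2r ?nnegrE ?bound_ge0//.
- apply: (jet_quotients_bound _ _ _ (B := fun j => `|x| ^+ j)) => [j t|j t h h0].
    by case: (norm_dcs j x t).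
  apply: (mvt_increment (f := fun t => (dcs j x t).1) (f' := fun t => (dcs j.+1 x t).1)) => // s.
    by case: (is_derive_dcs j x s).
  by case: (norm_dcs j.+1 x s).
- apply: (jet_quotients_bound _ _ _ (B := fun j => `|x| ^+ j)) => [j t|j t h h0].
    by case: (norm_dcs j x t).
  apply: (mvt_increment (f := fun t => (dcs j x t).2) (f' := fun t => (dcs j.+1 x t).2)) => // s.
    by case: (is_derive_dcs j x s).
  by case: (norm_dcs j.+1 x s).
Qed.

Let cvg_jet_symbol J l (x : R) :
  jet_symbol (jet_quotients J n l) x @[n --> \oo] --> jet_symbol l x.
Proof.
apply: cvgD; under eq_fun do rewrite expr2; rewrite expr2; apply: cvgM;
  apply: cvg_jet_quotients => j t;
  apply: (cvg_quotient_is_derive (f := fun t => _ (dcs j x t)));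
  by case: (is_derive_dcs j x t).
Qed.

(** Induction on the highest order of derivation: [normal_like] passes to the
    limit from difference quotients to derivatives, and so does the variance,
    by dominated convergence in the spectral integral. *)
Lemma normal_like_jet l :
  normal_like P (jet_variance l) (fun w => jet_comb l (path_derive w)).
Proof.
have [J lJ] : exists J, all (fun p => p.1.2 <= J)%N l.
  exists (\max_(p <- l) p.1.2)%N; apply/allP => p pl; exact: leq_bigmax_seq.
elim: J l lJ => [|J ih] l lJ; first exact: normal_like_jet0.
apply: (@normal_like_lim _ _ _ _ (fun n => jet_variance (jet_quotients J n l))
    (fun n w => jet_comb (jet_quotients J n l) (path_derive w))).
- by move=> n; apply: ih; exact: jet_quotients_order.
- apply: (dominated_cvg_Rintegral _ _ (integrable_bound l)) => [n|x|n x].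
  + exact: measurable_jet_symbol.
  + exact: cvg_jet_symbol.
  + exact: jet_symbol_quotients_bound.
- move=> w; apply: cvg_jet_quotients => j t.
  have dX : derivable (path_derive w j) t 1 by exact: (@X_smooth w j t).
  have h := cvg_difference_quotient dX; exact h.
Qed.

End process.

(** * Small balls *)

Lemma integral_cst_prob d (T : measurableType d) (R : realType)
  (P : probability T R) (r : R) : (\int[P]__ r%:E = r%:E)%E.
Proof. by rewrite integral_cst// [X in (_ * X)%E](_ : _ = 1%E) ?mule1//; exact: probability_setT. Qed.

Section fubini_bounded.
Context d1 d2 (T1 : measurableType d1) (T2 : measurableType d2) (R : realType)
  (P1 : probability T1 R) (P2 : probability T2 R).
Variables (f : T1 * T2 -> R) (M : R).
Hypotheses (mf : measurable_fun setT f) (fM : forall z, `|f z| <= M).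

Let intf : (P1 \x P2)%E.-integrable setT (EFin \o f).
Proof.
apply/integrable12ltyP; first exact/measurable_EFinP.
apply: (@le_lt_trans _ _ (\int[P1]_x \int[P2]_y M%:E)%E).
  apply: ge0_le_integral => //.
  - by move=> x _; apply: integral_ge0.
  - have mabs : measurable_fun setT (fun z => `|(f z)%:E|)%E.
      by apply: measurableT_comp => //; exact/measurable_EFinP.
    exact: (measurable_fun_fubini_tonelli_F _ mabs (fun z => abse_ge0 _)).
  - move=> x _; apply: ge0_le_integral => //.
    + apply: measurableT_comp => //; apply/measurable_EFinP.
      exact: (measurableT_comp mf (pair1_measurable x)).
    + by move=> y _; rewrite lee_fin.
under eq_integral do rewrite integral_cst_prob.
by rewrite integral_cst_prob ltry.
Qed.

Let int1 x : P2.-integrable setT (fun y => (f (x, y))%:E).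
Proof.
apply: (@integrable_bounded_prob _ _ _ P2 _ M) => //.
exact: (measurableT_comp mf (pair1_measurable x)).
Qed.

Let int2 y : P1.-integrable setT (fun x => (f (x, y))%:E).
Proof.
apply: (@integrable_bounded_prob _ _ _ P1 _ M) => //.
exact: (measurableT_comp mf (pair2_measurable y)).
Qed.

Lemma integrable_Rintegral1 : P1.-integrable setT (fun x => (\int[P2]_y f (x, y))%:E).
Proof.
have := integrable_fubini_F intf.
apply: eq_integrable => // y _; rewrite /Rintegral fineK//.
exact: integrable_fin_num.
Qed.

Lemma Rintegral_Fubini :
  \int[P1]_x \int[P2]_y f (x, y) = \int[P2]_y \int[P1]_x f (x, y).
Proof.
rewrite /Rintegral; congr fine.
under eq_integral do rewrite fineK ?integrable_fin_num//.
rewrite (Fubini intf); apply: eq_integral => y _.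
by rewrite fineK ?integrable_fin_num.
Qed.

End fubini_bounded.

Section small_ball.
Context (R : realType) (d : measure_display) (T : measurableType d)
  (P : probability T R).
Local Notation N := (normal_prob (0 : R) 1).

Lemma normal_exp_Nsqr (c : R) : 0 <= c ->
  \int[N]_x expR (- (c * (x : R) ^+ 2 / 2)) = (Num.sqrt (1 + c))^-1.
Proof.
move=> c0; set r := (Num.sqrt (1 + c))^-1.
have c1 : 0 < 1 + c by rewrite ltr_pwDl.
have r0 : 0 < r by rewrite invr_gt0 sqrtr_gt0.
have r2 : r ^+ 2 = (1 + c)^-1 by rewrite exprVn sqr_sqrtr// ltW.
rewrite /Rintegral (@integral_normal_scale _ 0 1 0 r r)//.
- apply: measurableT_comp => //; apply: measurableT_comp => //.
  by apply: measurable_funM => //; apply: measurable_funM => //; exact: measurable_funX.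
  exact: ltW.
have gE (y : R) : expR (- (c * y ^+ 2 / 2)) * normal_pdf 0 1 y = r * normal_pdf 0 r y.
  rewrite !normal_pdfE ?gt_eqF// /normal_fun /normal_peak.
  rewrite -[in RHS]mulrnAr sqrtrM ?sqr_ge0// sqrtr_sqr (gtr0_norm r0) invfM.
  rewrite -[in RHS]mulrA mulVKf ?gt_eqF// mulrCA expr1n mul1r -expRD; congr (_ * expR _).
  rewrite r2 !subr0 -[(1 + c)^-1 *+ 2]mulr_natr -[1 *+ 2]mulr_natr.
  by field; rewrite gt_eqF.
by move=> x; exact: gE.
Qed.

Variables (k : nat) (U : nat -> T -> R) (lam : R).
Hypotheses (mU : forall i, measurable_fun setT (U i)) (lam0 : 0 < lam).
(* The case of jointly Gaussian variables whose covariance matrix is at least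
   [lam] times the identity. *)
Hypothesis U_cos : forall b : nat -> R,
  \int[P]_w cos (\sum_(0 <= i < k) b i * U i w) <=
  expR (- (lam * (\sum_(0 <= i < k) b i ^+ 2) / 2)).

Let gauss_weight (s : R) (j : nat) (w : T) : R :=
  \prod_(0 <= i < j) expR (- (s * U i w ^+ 2 / 2)).

Let gauss_weight_ge0 s j w : 0 <= gauss_weight s j w.
Proof. by apply: prodr_ge0 => i _; exact: expR_ge0. Qed.

Let gauss_weight_le1 s j w : 0 <= s -> gauss_weight s j w <= 1.
Proof.
move=> s0; apply: Num.Theory.prodr_ile1 => i _; rewrite expR_ge0/= -[leRHS]expR0 ler_expR.
by rewrite oppr_le0 divr_ge0// mulr_ge0// sqr_ge0.
Qed.

Let measurable_gauss_weight s j : measurable_fun setT (gauss_weight s j).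
Proof.
apply: measurable_prod => i _; apply: measurableT_comp => //; apply: measurableT_comp => //.
by apply: measurable_funM => //; apply: measurable_funM => //; exact: measurable_funX.
Qed.

Let lin (b : nat -> R) (j : nat) (w : T) : R := \sum_(j <= i < k) b i * U i w.

Let measurable_lin b j : measurable_fun setT (lin b j).
Proof. by apply: measurable_sum => i; exact: measurable_funM. Qed.

Let integrable_cos_weight s (f : T -> R) j : 0 <= s -> measurable_fun setT f ->
  P.-integrable setT (EFin \o (fun w => cos (f w) * gauss_weight s j w)).
Proof.
move=> s0 mf; apply: (@integrable_bounded_prob _ _ _ P _ 1) => [|w].
  apply: measurable_funM => //; exact: (measurableT_comp measurable_cos).
rewrite normrM (ger0_norm (gauss_weight_ge0 _ _ _)) mulr_ile1//.
- exact: norm_cos_le1.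
- exact: gauss_weight_le1.
Qed.

(** The Gaussian weights are integrated one at a time, by induction on [j].
    One Gaussian factor is the average of [cos (sqrt s * g * U j)] over a
    standard Gaussian [g]; after exchanging the integrals, the product of two
    cosines becomes a sum of cosines of longer linear combinations. *)
Let cos_weight s (b : nat -> R) (j : nat) : 0 <= s -> (j <= k)%N ->
  \int[P]_w (cos (lin b j w) * gauss_weight s j w) <=
  expR (- (lam * (\sum_(j <= i < k) b i ^+ 2) / 2)) * (Num.sqrt (1 + lam * s))^-1 ^+ j.
Proof.
move=> s0; elim: j b => [|j ih] b jk.
  rewrite expr0 mulr1; apply: le_trans (U_cos b).
  rewrite le_eqVlt; apply/orP; left; apply/eqP; apply: eq_Rintegral => w _.
  by rewrite /gauss_weight big_geq// mulr1.
set r := (Num.sqrt _)^-1.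
pose h (g : R) (w : T) := cos (lin b j.+1 w) * gauss_weight s j w * cos (Num.sqrt s * U j w * g).
have hE w : cos (lin b j.+1 w) * gauss_weight s j.+1 w = \int[N]_g h g w.
  have ic : N.-integrable setT (EFin \o (fun x : measurableTypeR R => cos (Num.sqrt s * U j w * (x : R)))).
    apply: (@integrable_bounded_prob _ _ _ N _ 1) => [|y]; first exact: measurable_cosM.
    exact: norm_cos_le1.
  rewrite /h (RintegralZl _ measurableT ic) [X in _ = _ * X](normal_cosE (oner_neq0 R)).
  rewrite /gauss_weight big_nat_recr//= mulrA; congr (_ * expR _).
  by rewrite exprMn sqr_sqrtr// expr1n mulr1.
pose bj (c : R) (i : nat) := if i == j then c else b i.
have linbj c w : lin (bj c) j w = c * U j w + lin b j.+1 w.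
  rewrite /lin big_ltn// /bj eqxx; congr (_ + _).
  by apply: eq_big_nat => i /andP[ji _]; rewrite gtn_eqF.
have sumbj c : \sum_(j <= i < k) bj c i ^+ 2 = c ^+ 2 + \sum_(j.+1 <= i < k) b i ^+ 2.
  rewrite big_ltn// /bj eqxx; congr (_ + _).
  by apply: eq_big_nat => i /andP[ji _]; rewrite gtn_eqF.
have hP (g : R) : \int[P]_w h g w <=
    expR (- (lam * (\sum_(j.+1 <= i < k) b i ^+ 2) / 2)) * r ^+ j *
    expR (- (lam * s * g ^+ 2 / 2)).
  pose c := Num.sqrt s * g.
  have hcos w : h g w = 2^-1 * (cos (lin (bj c) j w) * gauss_weight s j w +
      cos (lin (bj (- c)) j w) * gauss_weight s j w).
    rewrite /h !linbj mulNr (addrC _ (lin _ _ _)) (addrC _ (lin _ _ _)) cosB cosD.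
    rewrite /c (mulrAC _ g).
    by set x := cos _; set y := cos _; field.
  have c2 : c ^+ 2 = s * g ^+ 2 by rewrite exprMn sqr_sqrtr.
  have i1 := @integrable_cos_weight s _ j s0 (measurable_lin (bj c) j).
  have i2 := @integrable_cos_weight s _ j s0 (measurable_lin (bj (- c)) j).
  under eq_Rintegral do rewrite hcos.
  rewrite RintegralZl//; last first.
    by rewrite /comp; under eq_fun do rewrite EFinD; exact: integrableD.
  rewrite RintegralD//.
  have := ih (bj c) (ltnW jk); have := ih (bj (- c)) (ltnW jk).
  rewrite !sumbj sqrrN c2 -/r.
  have -> : expR (- (lam * (s * g ^+ 2 + \sum_(j.+1 <= i < k) b i ^+ 2) / 2)) =
    expR (- (lam * (\sum_(j.+1 <= i < k) b i ^+ 2) / 2)) * expR (- (lam * s * g ^+ 2 / 2)).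
    by rewrite -expRD; congr expR; ring.
  rewrite (mulrAC (expR _) (expR _)).
  move: (\int[P]_w _) (\int[P]_w _) => x y; set z := _ * _ * _; lra.
pose hh (z : measurableTypeR R * T) : R := h z.1 z.2.
have mhh : measurable_fun setT hh.
  apply: measurable_funM.
    apply: measurable_funM; last exact: (measurableT_comp (measurable_gauss_weight s j)).
    apply: (measurableT_comp measurable_cos).
    exact: (measurableT_comp (measurable_lin b j.+1)).
  apply: (measurableT_comp measurable_cos); apply: measurable_funM.
    apply: measurable_funM => //; exact: (measurableT_comp (mU j)).
  exact: measurable_fst.
have hhM z : `|hh z| <= 1.
  rewrite /hh /h 2!normrM (ger0_norm (gauss_weight_ge0 _ _ _)).
  by rewrite !mulr_ile1 ?mulr_ge0// ?norm_cos_le1// gauss_weight_le1.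
have fub := @Rintegral_Fubini _ _ _ _ _ N P hh 1 mhh hhM.
have ihN := @integrable_Rintegral1 _ _ _ _ _ N P hh 1 mhh hhM.
under eq_Rintegral do rewrite hE.
rewrite -[leLHS]fub.
have ls0 : 0 <= lam * s by rewrite mulr_ge0// ltW.
set C := expR _; rewrite exprSr mulrA -[X in _ <= _ * X](normal_exp_Nsqr ls0).
have ie : N.-integrable setT (EFin \o (fun g : measurableTypeR R => expR (- (lam * s * (g : R) ^+ 2 / 2)))).
  apply: (@integrable_bounded_prob _ _ _ N _ 1) => [|y].
    apply: measurableT_comp => //; apply: measurableT_comp => //.
    by apply: measurable_funM => //; apply: measurable_funM => //; exact: measurable_funX.
  rewrite ger0_norm ?expR_ge0// -[leRHS]expR0 ler_expR oppr_le0 divr_ge0//.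
  by rewrite mulr_ge0// sqr_ge0.
rewrite -(RintegralZl _ measurableT ie).
apply: le_Rintegral => //.
- rewrite /comp; under eq_fun do rewrite EFinM; exact: integrableZl.
- by move=> g _; exact: hP.
Qed.

(** On the event, the product of the [exp (- U i ^ 2 / (2 * eta ^ 2))] is at least
    [exp (- k / 2)], while [cos_weight] with [b = 0] bounds its mean. *)
Lemma small_ball (eta : R) : 0 < eta ->
  (P [set w | forall i, (i < k)%N -> (`|U i w| <= eta)%R] <=
   ((expR (1 / 2) * eta / Num.sqrt lam) ^+ k)%:E)%E.
Proof.
move=> eta0; set A := [set w | _].
have mA : measurable A.
  rewrite (_ : A = \bigcap_(i in `I_k) [set w | `|U i w| <= eta]); last first.
    by apply/seteqP; split => w; [move=> h i; exact: h|move=> h i ik; exact: h].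
  apply: bigcap_measurableType => i _.
  rewrite -[X in measurable X]setTI; apply: measurable_fun_le => //.
  exact: measurableT_comp.
pose s := (eta ^+ 2)^-1.
have s0 : 0 < s by rewrite invr_gt0 exprn_gt0.
have iw : P.-integrable setT (EFin \o gauss_weight s k).
  have := @integrable_cos_weight s (cst 0) k (ltW s0) (measurable_cst _).
  by apply: eq_integrable => // w _; rewrite /= cos0 mul1r.
have h1 : \int[P]_w gauss_weight s k w <= (eta / Num.sqrt lam) ^+ k.
  have := cos_weight (fun=> 0) (ltW s0) (leqnn k).
  rewrite big_geq// mulr0 mul0r oppr0 expR0 mul1r.
  under eq_Rintegral do rewrite /lin big_geq// cos0 mul1r.
  move/le_trans; apply; apply: lerXn2r; rewrite ?nnegrE ?invr_ge0 ?sqrtr_ge0//.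
    by rewrite divr_ge0 ?sqrtr_ge0// ltW.
  have sl0 : 0 < Num.sqrt lam by rewrite sqrtr_gt0.
  have -> : eta / Num.sqrt lam = (Num.sqrt (lam * s))^-1.
    by rewrite sqrtrM ?ltW// /s sqrtrV ?sqr_ge0// sqrtr_sqr gtr0_norm// invfM invrK mulrC.
  rewrite lef_pV2 ?posrE ?sqrtr_gt0 ?mulr_gt0// ?ltr_wpDl ?mulr_gt0// ?addr_gt0 ?mulr_gt0//.
  by rewrite ler_wsqrtr// lerDr.
have c0 : 0 <= expR (- (1 / 2) : R) ^+ k by rewrite exprn_ge0// expR_ge0.
have h2 : ((expR (- (1 / 2)) ^+ k)%:E * P A <= (\int[P]_w gauss_weight s k w)%:E)%E.
  rewrite /Rintegral fineK; last exact: integrable_fin_num.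
  have -> : P A = (\int[P]_w (\1_A w)%:E)%E by rewrite integral_indic// setIT.
  rewrite -ge0_integralZl//; last exact/measurable_EFinP.
  apply: ge0_le_integral => //.
  - by apply: measurable_funeM; exact/measurable_EFinP.
  - by apply/measurable_EFinP.
  - move=> w _; rewrite -EFinM lee_fin indicE.
    have [/set_mem wA|_] := boolP (w \in A); last by rewrite mulr0.
    rewrite mulr1 -[k in leLHS]subn0 -prodr_const_nat /gauss_weight.
    rewrite big_nat [leRHS]big_nat; apply: ler_prod => i /andP[_ ik].
    rewrite expR_ge0/= ler_expR lerN2 ler_pM2r// /s mulrC ler_pdivrMr ?exprn_gt0// mul1r.
    rewrite -[leLHS]real_normK ?num_real//; apply: lerXn2r; last exact: wA.
    + by rewrite nnegrE.
    + by rewrite nnegrE ltW.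
have := le_trans h2 _; move=> /(_ _ (_ : _ <= ((eta / Num.sqrt lam) ^+ k)%:E)%E).
rewrite lee_fin => /(_ h1).
rewrite -lee_pdivlMl ?exprn_gt0 ?expR_gt0//; move/le_trans; apply.
by rewrite -EFinM lee_fin -exprVn expRN invrK -exprMn mulrA.
Qed.

End small_ball.

(** * Polynomials in the spectral space *)

Section separated_points.
Context {R : realType}.
Local Notation leb := (@lebesgue_measure R).

(** Greedy choice: intervals of radius [r] around fewer than [n] points cannot
    cover a set of measure larger than [2 r n]. *)
Lemma separated_points (E : set (measurableTypeR R)) (r : R) (n : nat) :
  measurable E -> 0 < r -> ((n%:R * (2 * r))%:E < leb E)%E ->
  exists xs : seq R, [/\ size xs = n, forall x, x \in xs -> E x &
    pairwise (fun x y => r <= `|x - y|) xs].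
Proof.
move=> mE r0 En.
suff h k : (k <= n)%N -> exists xs : seq R, [/\ size xs = k,
    forall x, x \in xs -> E x & pairwise (fun x y => r <= `|x - y|) xs] by exact: h.
elim: k => [|k ih] kn; first by exists [::].
have [xs [sxs Exs pxs]] := ih (ltnW kn).
pose V i : set (measurableTypeR R) := [set` `](xs`_i - r), (xs`_i + r)[%R].
have mV i : measurable (V i) by exact: measurable_itv.
have [x [Ex xV]] : exists x, E x /\ ~ (\big[setU/set0]_(i < k) V i) x.
  apply: contrapT => noE.
  have EV : E `<=` \big[setU/set0]_(i < k) V i.
    by move=> x Ex; apply: contrapT => xV; apply: noE; exists x.
  have h : (leb E <= \sum_(i < k) leb (V i))%E.
    by apply: content_subadditive => // i _; exact: mV.
  move: h; rewrite leNgt => /negP; apply; apply: le_lt_trans En.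
  rewrite (eq_bigr (fun=> (2 * r)%:E)); last first.
    move=> i _; rewrite /V lebesgue_measure_itv/= lte_fin ltrBlDr -addrA ltrDl addr_gt0//.
    by rewrite -EFinB; congr EFin; ring.
  rewrite sumEFin sumr_const card_ord lee_fin -[_ *+ k]mulr_natl.
  by rewrite ler_wpM2r ?mulr_ge0 ?(ltW r0)// ler_nat ltnW.
exists (x :: xs); split => /=.
- by rewrite sxs.
- by move=> y; rewrite inE => /predU1P[->//|]; exact: Exs.
- rewrite pxs andbT; apply/allP => y yxs; rewrite leNgt; apply/negP => xy.
  apply: xV; rewrite -bigcup_mkord; exists (index y xs); first by rewrite /= -sxs index_mem.
  by rewrite /V /= in_itv/= nth_index// -ltr_distl.
Qed.

End separated_points.

Section sublevel.
Context {R : realType}.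

(** By induction: dividing [p - p(x0)] by ['X - x0] lowers the degree, and
    costs a factor [2 / r] on the values at the other points. *)
Lemma coef_bound (n : nat) (p : {poly R}) (xs : seq R) (A r tau : R) :
  0 <= A -> 0 < r -> 0 <= tau -> (size p <= n)%N -> size xs = n ->
  (forall x, x \in xs -> `|x| <= A) ->
  pairwise (fun x y => r <= `|x - y|) xs ->
  (forall x, x \in xs -> `|p.[x]| <= tau) ->
  forall i, `|p`_i| <= (1 + 2 * (1 + A) / r) ^+ n * tau.
Proof.
move=> A0 r0; elim: n p xs tau => [|n ih] p xs tau tau0 sp sxs xsA pxs ptau i.
  move: sp; rewrite leqn0 size_poly_eq0 => /eqP ->.
  by rewrite coef0 normr0 mulr_ge0// exprn_ge0.
case: xs sxs xsA pxs ptau => // x0 xs [sxs] xsA /=/andP[/allP px0 pxs] ptau.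
have /factor_theorem[q qE] : root (p - p.[x0]%:P) x0.
  by rewrite /root !hornerE subrr.
have pE : p = q * ('X - x0%:P) + p.[x0]%:P by rewrite -qE subrK.
have sq : (size q <= n)%N.
  have [->|q0] := eqVneq q 0; first by rewrite size_poly0.
  have : (size (p - p.[x0]%:P)%R <= n.+1)%N.
    rewrite (leq_trans (size_polyD _ _))// geq_max sp size_polyN.
    by rewrite (leq_trans (size_polyC_leq1 _)).
  by rewrite qE size_Mmonic ?monicXsubC// size_XsubC addn2.
have B1 : 1 <= 1 + 2 * (1 + A) / r.
  by rewrite lerDl divr_ge0 ?(ltW r0)// mulr_ge0// addr_ge0.
set B := 1 + _ in B1 *.
have qb : forall i, `|q`_i| <= B ^+ n * (2 * tau / r).
  apply: (ih q xs) => //.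
  - by rewrite divr_ge0 ?(ltW r0)// mulr_ge0.
  - by move=> x xxs; apply: xsA; rewrite inE xxs orbT.
  - move=> x xxs; rewrite ler_pdivlMr//.
    have := px0 _ xxs; rewrite distrC => rx.
    have e : q.[x] * (x - x0) = p.[x] - p.[x0].
      by rewrite -[in RHS](hornerC p.[x0] x) -hornerN -hornerD qE !hornerE.
    apply: (@le_trans _ _ (`|q.[x]| * `|x - x0|)); first by rewrite ler_wpM2l.
    rewrite -normrM e; apply: (le_trans (ler_normB _ _)).
    rewrite mulr_natl mulr2n; apply: lerD; apply: ptau.
      by rewrite inE xxs orbT.
    by rewrite inE eqxx.
have x0A : `|x0| <= A by apply: xsA; rewrite inE eqxx.
have p0 : `|p.[x0]| <= tau by apply: ptau; rewrite inE eqxx.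
have Bn1 : 1 <= B ^+ n by rewrite exprn_ege1.
have Bn0 : 0 <= B ^+ n by rewrite (le_trans ler01).
have Bq0 : 0 <= B ^+ n * (2 * tau / r).
  by rewrite mulr_ge0// divr_ge0 ?(ltW r0)// mulr_ge0.
have -> : p`_i = (if i == 0%N then 0 else q`_i.-1) - q`_i * x0 + (if i == 0%N then p.[x0] else 0).
  by rewrite {1}pE mulrBr coefD coefB coefMX coefMC coefC.
have h1 : `|if i == 0%N then 0 else q`_i.-1| <= B ^+ n * (2 * tau / r).
  by case: eqP => _; [rewrite normr0|exact: qb].
have h2 : `|q`_i * x0| <= B ^+ n * (2 * tau / r) * A by rewrite normrM ler_pM.
have h3 : `|if i == 0%N then p.[x0] else 0| <= B ^+ n * tau.
  case: eqP => _; last by rewrite normr0 mulr_ge0.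
  by apply: (le_trans p0); rewrite ler_peMl.
have -> : B ^+ n.+1 * tau = B ^+ n * (2 * tau / r) + B ^+ n * (2 * tau / r) * A + B ^+ n * tau.
  by rewrite exprS {1}/B; field; rewrite gt_eqF.
apply: (le_trans (ler_normD _ _)); apply: lerD => //.
by apply: (le_trans (ler_normB _ _)); exact: lerD.
Qed.

End sublevel.

Section absolute_continuity.
Context {R : realType}.
Local Notation leb := (@lebesgue_measure R).

(** Otherwise there are sets of Lebesgue measure at most [2 ^ - n] and of
    [nu]-measure larger than [eps]; by the lemma of Borel and Cantelli their
    upper limit is Lebesgue null but not [nu]-null. *)
Lemma dominates_eps_delta (nu : {measure set (measurableTypeR R) -> \bar R}) :
  (nu setT < +oo)%E -> nu `<< leb ->
  forall eps : R, 0 < eps -> exists2 delta : R, 0 < delta &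
    forall B : set (measurableTypeR R), measurable B -> (leb B <= delta%:E)%E -> (nu B <= eps%:E)%E.
Proof.
move=> nufin /null_content_dominatesP nuleb eps eps0; apply: contrapT => noD.
have /choice[B HB] : forall n : nat, exists B : set (measurableTypeR R),
    [/\ measurable B, (leb B <= (1 / (2 ^ n.+1)%:R)%:E)%E & (eps%:E < nu B)%E].
  move=> n; apply: contrapT => noB; apply: noD; exists (1 / (2 ^ n.+1)%:R).
    by rewrite divr_gt0// ltr0n expn_gt0.
  move=> B mB lB; rewrite leNgt; apply/negP => nB; apply: noB.
  by exists B; split.
have mB n : measurable (B n) by case: (HB n).
have l0 : leb (lim_sup_set B) = 0%E.
  apply: lim_sup_set_cvg0 => //.
  apply: (@le_lt_trans _ _ (\sum_(i <oo) (1 / (2 ^ i.+1)%:R)%:E)%E).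
    by apply: lee_nneseries => n _ //; case: (HB n).
  apply: (le_lt_trans (epsilon_trick0 xpredT ler01)); exact: ltry.
have mL : measurable (lim_sup_set B).
  by apply: bigcapT_measurable => n; apply: bigcup_measurable => k _.
have n0 := nuleb _ mL l0.
have : nu (\bigcup_(k >= n) B k) @[n --> \oo] --> 0%E.
  rewrite -n0; apply: lim_sup_set_cvg => //.
  apply: le_lt_trans nufin; apply: le_measure; rewrite ?inE//.
  by apply: bigcup_measurable => k _.
move=> /fine_cvgP[_ /cvgrPdist_lt/(_ _ eps0)].
move=> [n _ /(_ n (leqnn n))] /=; rewrite sub0r normrN.
have fnu : nu (\bigcup_(k >= n) B k) \is a fin_num.
  rewrite ge0_fin_numE//; apply: le_lt_trans nufin; apply: le_measure; rewrite ?inE//.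
  by apply: bigcup_measurable => k _.
rewrite ger0_norm ?fine_ge0// -lte_fin fineK// ltNge => /negP; apply.
have [_ _ /ltW h] := HB n; apply: (le_trans h).
apply: le_measure; rewrite ?inE//; first by apply: bigcup_measurable => k _.
by move=> x Bx; exists n => //=.
Qed.

End absolute_continuity.

Section spectral_lower_bound.
Context {R : realType}.
Variable mu : probability (measurableTypeR R) R.
Local Notation leb := (@lebesgue_measure R).

(** Let [c] be the modulus of a coefficient. The set where [|p|] is smaller than
    [tau], of order [c] divided by the constant of [coef_bound], has small
    Lebesgue measure, for otherwise it would contain [n] separated points.
    Hence [|p| > tau] on a set whose measure for the absolutely continuous part
    of [mu] is bounded below independently of [p]. *)
Lemma sqr_poly_integral_lower (mu_ac : has_nontrivial_ac_part mu) :
  exists2 D : R, 1 <= D & forall (n : nat) (p : {poly R}),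
    (0 < n)%N -> (size p <= n)%N ->
    mu.-integrable setT (EFin \o (fun x : measurableTypeR R => p.[x] ^+ 2)) ->
    forall i, p`_i ^+ 2 <= D * (D * n%:R) ^+ (2 * n) * \int[mu]_x (p.[x] ^+ 2).
Proof.
have [nu [nus [nuleb _ muE nu0]]] := mu_ac.
have nuT : (nu setT < +oo)%E.
  apply: (@le_lt_trans _ _ 1%E); last exact: ltry.
  by rewrite -(@probability_setT _ _ _ mu) muE// leeDl.
have fnu B : measurable B -> nu B \is a fin_num.
  move=> mB; rewrite ge0_fin_numE//; apply: le_lt_trans nuT.
  by apply: le_measure; rewrite ?inE.
have nule B : measurable B -> (nu B <= mu B)%E by move=> mB; rewrite muE// leeDl.
pose I (N : nat) : set (measurableTypeR R) := [set` `[- N%:R, N%:R]%R].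
have mI N : measurable (I N) by exact: measurable_itv.
have [N nuN] : exists N, (0 < nu (I N))%E.
  apply: contrapT => noN; move/eqP: nu0; apply.
  have UI : \bigcup_N (I N) = setT.
    apply/seteqP; split => // x _.
    have [N _ hN] := nbhs_infty_ger `|x|.
    by exists N => //; rewrite /I /= in_itv/= -ler_norml; exact: (hN N (leqnn N)).
  apply/negligibleP => //; rewrite -UI; apply: negligible_bigcup => N.
  apply/negligibleP => //; apply/eqP; rewrite eq_le measure_ge0 andbT leNgt.
  by apply/negP => h; apply: noN; exists N.
pose e := fine (nu (I N)).
have e0 : 0 < e by rewrite fine_gt0// nuN ltey_eq fnu.
have nuIE : nu (I N) = e%:E by rewrite fineK ?fnu.
have e2 : 0 < e / 2 by rewrite divr_gt0.
have [dl dl0 hdl] := dominates_eps_delta nuT nuleb e2.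
pose D1 := 1 + 4 * (1 + N%:R) / dl.
have D11 : 1 <= D1 by rewrite lerDl divr_ge0 ?(ltW dl0)// mulr_ge0// addr_ge0.
exists (D1 + 8 / e).
  by apply: (le_trans D11); rewrite lerDl divr_ge0// ltW.
move=> n p n0 sp ip i.
have n1 : 1 <= n%:R :> R by rewrite ler1n.
pose r := dl / (2 * n%:R).
have r0 : 0 < r by rewrite divr_gt0// mulr_gt0// ltr0n.
pose B := 1 + 2 * (1 + N%:R) / r.
have B0 : 0 < B by rewrite ltr_pwDl// divr_ge0 ?(ltW r0)// mulr_ge0// addr_ge0.
have BD : B <= (D1 + 8 / e) * n%:R.
  apply: (@le_trans _ _ (D1 * n%:R)); last by rewrite ler_wpM2r// lerDl divr_ge0// ltW.
  have rE : 2 * (1 + N%:R) / r = 4 * (1 + N%:R) / dl * n%:R.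
    by rewrite /r; field; rewrite !gt_eqF// ltr0n.
  by rewrite /B rE /D1 [leRHS]mulrDl mul1r lerD2r.
pose c := `|p`_i|.
have [c0|cn0] := eqVneq c 0.
  have -> : p`_i = 0 by apply/eqP; rewrite -normr_eq0; apply/eqP.
  rewrite expr0n/= mulr_ge0//; last by apply: Rintegral_ge0 => x _; exact: sqr_ge0.
  by rewrite mulr_ge0// ?exprn_ge0 ?mulr_ge0// addr_ge0 ?divr_ge0 ?ltW// (lt_le_trans ltr01).
have c0 : 0 < c by rewrite lt_def cn0 normr_ge0.
pose tau := c / (2 * B ^+ n).
have Bn0 : 0 < B ^+ n by rewrite exprn_gt0.
have tau0 : 0 < tau by rewrite divr_gt0// mulr_gt0.
pose S : set (measurableTypeR R) := I N `&` [set x | `|p.[x]| <= tau].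
have mp : measurable_fun setT (fun x : measurableTypeR R => p.[x]).
  by apply: continuous_measurable_fun => x; exact: continuous_horner.
have mS : measurable S.
  apply: measurableI => //; rewrite -[X in measurable X]setTI.
  by apply: measurable_fun_le => //; exact: measurableT_comp.
have lS : (leb S <= dl%:E)%E.
  rewrite leNgt; apply/negP => dlS.
  have nr : ((n%:R * (2 * r))%:E < leb S)%E.
    apply: le_lt_trans dlS; rewrite lee_fin /r.
    by rewrite le_eqVlt; apply/orP; left; apply/eqP; field; rewrite gt_eqF// ltr0n.
  have [xs [sxs Sxs pxs]] := separated_points mS r0 nr.
  have := @coef_bound _ n p xs N%:R r tau (ler0n _ _) r0 (ltW tau0) sp sxs _ pxs _ i.
  move=> h; have {h} : c <= B ^+ n * tau.
    apply: h => x /Sxs[]; rewrite /I/= ?in_itv/= ?ler_norml//.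
  have -> : B ^+ n * tau = c / 2 by rewrite /tau; field; rewrite gt_eqF.
  by lra.
have nuS : (nu (I N `\` S) >= (e / 2)%:E)%E.
  have hD : nu (I N) = (nu (I N `\` S) + nu S)%E.
    have IS : I N `&` S = S by rewrite setIA setIid.
    have := measureDI nu (mI N) mS; rewrite IS => h; exact h.
  have hS := hdl _ mS lS.
  have mIS : measurable (I N `\` S) by exact: measurableD.
  move: hD hS; rewrite nuIE -(fineK (fnu _ mS)) -(fineK (fnu _ mIS)) -EFinD !lee_fin => -[h1] h2.
  lra.
have key : tau ^+ 2 * (e / 2) <= \int[mu]_x (p.[x] ^+ 2).
  have mIS : measurable (I N `\` S) by exact: measurableD.
  rewrite -lee_fin /Rintegral fineK; last exact: integrable_fin_num.
  apply: (@le_trans _ _ (\int[mu]_(x in I N `\` S) (tau ^+ 2)%:E)%E).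
    rewrite integral_cst// EFinM lee_pmul2l// ?lte_fin ?exprn_gt0//.
    exact: le_trans nuS (nule _ mIS).
  have mp2 : measurable_fun setT (fun x : measurableTypeR R => (p.[x] ^+ 2)%:E).
    by apply/measurable_EFinP; exact: measurable_funX.
  apply: (@le_trans _ _ (\int[mu]_(x in I N `\` S) (p.[x] ^+ 2)%:E)%E).
    apply: ge0_le_integral => //.
    - by move=> x _; rewrite lee_fin sqr_ge0.
    - exact: measurable_funTS.
    - move=> x [Ix /= nSx]; rewrite lee_fin -[leRHS]real_normK ?num_real//.
      apply: lerXn2r; rewrite ?nnegrE ?(ltW tau0)//.
      by rewrite leNgt; apply/negP => /ltW h; apply: nSx; split.
  by apply: ge0_subset_integral => // x _; rewrite lee_fin sqr_ge0.
have -> : p`_i ^+ 2 = c ^+ 2 by rewrite real_normK// num_real.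
have Bn2 : B ^+ (2 * n) = B ^+ n ^+ 2 by rewrite mulnC exprM.
apply: (@le_trans _ _ (8 / e * B ^+ (2 * n) * (tau ^+ 2 * (e / 2)))).
  rewrite Bn2 /tau le_eqVlt; apply/orP; left; apply/eqP; field.
  by rewrite !gt_eqF.
have D0 : 0 <= D1 + 8 / e by rewrite addr_ge0 ?divr_ge0 ?(ltW e0)// (le_trans ler01).
apply: ler_pM => //.
- by rewrite mulr_ge0 ?divr_ge0 ?(ltW e0)// exprn_ge0// ltW.
- by rewrite mulr_ge0 ?sqr_ge0// ltW.
- apply: ler_pM => //.
  + by rewrite divr_ge0// ltW.
  + by rewrite exprn_ge0// ltW.
  + by rewrite lerDr (le_trans ler01).
  + by apply: lerXn2r; rewrite ?nnegrE ?(ltW B0)// mulr_ge0.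
Qed.

End spectral_lower_bound.

(** * Derivatives at a point and in the mean *)

Section process_small_ball.
Context (R : realType) (d : measure_display) (T : measurableType d)
  (P : probability T R) (X : R -> {RV P >-> R}).
Variable mu : probability (measurableTypeR R) R.
Hypotheses (X_gaussian : gaussian_process X) (X_centered : centered X)
  (X_stationary : stationary X) (X_smooth : smooth_paths X)
  (X_mu : is_spectral_measure X mu) (mu_moments : finite_moments mu).

Lemma dcs_even j (x t : R) :
  dcs j.*2 x t = ((-1) ^+ j * x ^+ j.*2 * cos (t * x), (-1) ^+ j * x ^+ j.*2 * sin (t * x)).
Proof.
elim: j => [|j ih]; first by rewrite /= !expr0 !mul1r.
by rewrite doubleS /= ih /= !exprS; congr pair; ring.
Qed.

Lemma integrable_horner (p : {poly R}) :
  mu.-integrable setT (EFin \o (fun x : measurableTypeR R => p.[x])).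
Proof.
rewrite /comp; under eq_fun do rewrite horner_coef.
apply: integrable_sumR => i; rewrite /comp; under eq_fun do rewrite EFinM.
apply: integrableZl => //; apply: le_integrable (mu_moments i) => //.
- by apply/measurable_EFinP; exact: measurable_funX.
- by move=> x _; rewrite lee_fin !normrX normr_id.
Qed.

(* The combination of the [X^(2j)(t)] with coefficients [b j], and the polynomial
   whose square is its spectral density. *)
Let jet_even_poly (b : nat -> R) (k : nat) : {poly R} :=
  \sum_(i < k) (b i * (-1) ^+ i) *: 'X^(i.*2).

Let jet_even (b : nat -> R) (k : nat) (t : R) : seq (R * nat * R) :=
  [seq (b i, i.*2, t) | i <- iota 0 k].

Let jet_evenE b k t (E : nat -> R -> R) :
  jet_comb (jet_even b k t) E = \sum_(0 <= i < k) b i * E i.*2 t.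
Proof. by rewrite /jet_comb /jet_even big_map /index_iota subn0. Qed.

Let jet_symbol_even b k t (x : R) :
  jet_symbol (jet_even b k t) x = (jet_even_poly b k).[x] ^+ 2.
Proof.
have hE (c : R) : \sum_(0 <= i < k) b i * ((-1) ^+ i * x ^+ i.*2 * c) = (jet_even_poly b k).[x] * c.
  rewrite big_mkord horner_sum mulr_suml; apply: eq_bigr => i _.
  by rewrite hornerZ hornerXn; ring.
rewrite /jet_symbol !jet_evenE.
rewrite (eq_bigr (fun i => b i * ((-1) ^+ i * x ^+ i.*2 * cos (t * x)))); last first.
  by move=> i _; rewrite dcs_even.
rewrite hE (eq_bigr (fun i => b i * ((-1) ^+ i * x ^+ i.*2 * sin (t * x)))); last first.
  by move=> i _; rewrite dcs_even.
rewrite hE -[RHS]mulr1 -(cos2Dsin2 (t * x)); ring.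
Qed.

Let size_jet_even b k : (size (jet_even_poly b k) <= k.*2)%N.
Proof.
apply: (leq_trans (size_sum _ _ _)); apply/bigmax_leqP => i _.
rewrite (leq_trans (size_scale_leq _ _))// size_polyXn.
by rewrite ltn_double ltn_ord.
Qed.

Let coef_jet_even b k i : (i < k)%N -> (jet_even_poly b k)`_i.*2 ^+ 2 = b i ^+ 2.
Proof.
move=> ik; rewrite coef_sum (bigD1 (Ordinal ik))//= big1 ?addr0.
  by rewrite coefZ coefXn eqxx mulr1 exprMn -exprM mulnC exprM sqrrN !expr1n mulr1.
move=> j /eqP ji; rewrite coefZ coefXn; case: eqP => [e|_]; last by rewrite mulr0.
by exfalso; apply: ji; apply/val_inj => /=; apply/double_inj.
Qed.

Lemma measurable_path_derive j t : measurable_fun setT (fun w => path_derive X w j t).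
Proof.
have [+ _ _] := normal_like_jet X_gaussian X_centered X_stationary X_smooth X_mu mu_moments
  [:: (1, j, t)].
by apply: eq_measurable_fun => w _; rewrite /jet_comb big_seq1 mul1r.
Qed.

(** The variance of the sum of the [b j * X^(2j)(t)], for [j < k], is the integral
    of the square of the polynomial with coefficients [(-1) ^ j * b j] at the even
    degrees, whatever [t]. By [sqr_poly_integral_lower] it is at least the sum of
    the [b j ^ 2] times a quantity of order [exp (- C k log k)]: this is the
    hypothesis of [small_ball]. Even orders make the polynomial real. *)
Lemma derivatives_small_ball (mu_ac : has_nontrivial_ac_part mu) :
  exists2 D : R, 1 <= D & forall (k : nat) (t eta : R), (0 < k)%N -> 0 < eta ->
    (P [set w | forall j, (j < k)%N -> (`|path_derive X w j.*2 t| <= eta)%R] <=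
     ((expR (1 / 2) * eta * (k%:R * (D * (D * k.*2%:R) ^+ (4 * k)))) ^+ k)%:E)%E.
Proof.
have [D D1 hD] := sqr_poly_integral_lower mu_ac.
exists D => // k t eta k0 eta0.
set L := k%:R * _.
have k1 : 1 <= k%:R :> R by rewrite ler1n.
have L1 : 1 <= L.
  rewrite /L -[leLHS]mulr1 ler_pM// -[leLHS]mulr1 ler_pM// exprn_ege1//.
  by rewrite -[leLHS]mulr1 ler_pM// ler1n double_gt0.
have L0 : 0 < L by rewrite (lt_le_trans ltr01).
have njet b := normal_like_jet X_gaussian X_centered X_stationary X_smooth X_mu mu_moments
  (jet_even b k t).
have mU i := measurable_path_derive i.*2 t.
have Ucos b : \int[P]_w cos (\sum_(0 <= i < k) b i * path_derive X w i.*2 t) <=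
    expR (- ((L ^- 2) * (\sum_(0 <= i < k) b i ^+ 2) / 2)).
  have [_ hcos _] := njet b.
  have := hcos 1; under eq_Rintegral do rewrite mul1r jet_evenE.
  move=> ->; rewrite ler_expR lerN2 expr1n mul1r ler_pM2r//.
  rewrite ler_pdivrMl ?exprn_gt0// /jet_variance.
  have ip : mu.-integrable setT (EFin \o (fun x : measurableTypeR R => (jet_even_poly b k).[x] ^+ 2)).
    have := integrable_horner (jet_even_poly b k ^+ 2).
    by apply: eq_integrable => // x _; rewrite /= horner_exp.
  under [in leRHS]eq_Rintegral do rewrite jet_symbol_even.
  have k20 : (0 < k.*2)%N by rewrite double_gt0.
  have hb i : (i < k)%N -> b i ^+ 2 <= L / k%:R * \int[mu]_x ((jet_even_poly b k).[x] ^+ 2).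
    move=> ik; rewrite -(coef_jet_even b ik).
    apply: (le_trans (hD _ _ k20 (size_jet_even b k) ip i.*2)).
    have -> : L / k%:R = D * (D * k.*2%:R) ^+ (4 * k).
      by rewrite /L mulrAC divff ?mul1r// gt_eqF// ltr0n.
    by rewrite -[(4 * k)%N](_ : 2 * k.*2 = _)%N// -mul2n mulnA.
  have I0 : 0 <= \int[mu]_x ((jet_even_poly b k).[x] ^+ 2).
    by apply: Rintegral_ge0 => x _; exact: sqr_ge0.
  apply: (@le_trans _ _ (L * \int[mu]_x ((jet_even_poly b k).[x] ^+ 2))).
    rewrite big_mkord.
    apply: (@le_trans _ _ (\sum_(i < k) (L / k%:R * \int[mu]_x ((jet_even_poly b k).[x] ^+ 2)))).
      by apply: ler_sum => i _; exact: hb.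
    rewrite sumr_const card_ord -[_ *+ k]mulr_natl mulrA mulrCA divff ?mulr1//.
    by rewrite gt_eqF// ltr0n.
  by rewrite ler_wpM2r// expr2 ler_peMl// ltW.
have lam0 : 0 < L ^- 2 by rewrite invr_gt0 exprn_gt0.
have := small_ball mU lam0 Ucos eta0.
by rewrite sqrtrV ?sqr_ge0// sqrtr_sqr gtr0_norm// invrK.
Qed.

Lemma exp_sqr_path_derive j t (q : R) : abs_moment mu (2 * j) < q ->
  (\int[P]_w (expR (path_derive X w j t ^+ 2 / (4 * q)))%:E <= (Num.sqrt 2)%:E)%E.
Proof.
move=> Cq.
have [_ _ h] := normal_like_jet X_gaussian X_centered X_stationary X_smooth X_mu mu_moments
  [:: (1, j, t)].
have vE : jet_variance mu [:: (1, j, t)] = abs_moment mu (2 * j).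
  rewrite /jet_variance /abs_moment; apply: eq_Rintegral => x _.
  rewrite /jet_symbol /jet_comb !big_seq1/= !mul1r dcs_sqr.
  by rewrite mulnC exprM -normrX -normrX ger0_norm// sqr_ge0.
have q0 : 0 < q.
  by apply: le_lt_trans Cq; apply: Rintegral_ge0 => x _; rewrite exprn_ge0.
have := h q q0; rewrite vE => /(_ Cq).
by under eq_integral do rewrite /jet_comb big_seq1 mul1r.
Qed.

Let continuous_path w j : continuous (path_derive X w j).
Proof. by move=> x; apply/differentiable_continuous/derivable1_diffP; exact: (@X_smooth w j x). Qed.

(** Exchanging integrals needs joint measurability, obtained through the values of [X] at the points of a grid
    of step [1 / n.+1]; the absolute value keeps the grid indexed by [nat]. *)
Lemma measurable_path_derive2 j :
  measurable_fun setT (fun z : measurableTypeR R * T => path_derive X z.2 j `|z.1 : R|).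
Proof.
elim: j => [|j ih].
  pose s_ n (s : R) : nat := Num.truncn (n.+1%:R * `|s|).
  pose g n (z : measurableTypeR R * T) : R := X ((s_ n z.1)%:R / n.+1%:R) z.2.
  apply: (@measurable_fun_cvg _ _ _ _ g) => // [n|[s w] _].
    move=> _ A mA; rewrite setTI.
    rewrite (_ : g n @^-1` A = \bigcup_i ([set s | s_ n s = i] `*` (X (i%:R / n.+1%:R) @^-1` A))); last first.
      apply/seteqP; split => [[s w] /= h|[s w] [i _ [/= <-]]//].
      by exists (s_ n s).
    apply: bigcupT_measurable => i; apply: measurableX; last first.
      by rewrite -[X in measurable X]setTI; apply: measurable_funPT.
    rewrite (_ : [set s | _] = [set s : measurableTypeR R | i%:R <= n.+1%:R * `|s : R|] `&`
        [set s : measurableTypeR R | n.+1%:R * `|s : R| < i.+1%:R]); last first.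
      apply/seteqP; split => s /=.
        by move=> <-; have /andP[] := truncn_itv (mulr_ge0 (ler0n R n.+1) (normr_ge0 s)).
      by move=> [h1 h2]; apply: truncn_def; rewrite h1 h2.
    have mn : measurable_fun setT (fun s : measurableTypeR R => n.+1%:R * `|s : R|).
      by apply: measurable_funM => //; exact: measurableT_comp.
    apply: measurableI.
    - by rewrite -[X in measurable X]setTI; exact: measurable_fun_le.
    - rewrite (_ : [set s | _] = ~` [set s : measurableTypeR R | i.+1%:R <= n.+1%:R * `|s : R|]).
        by apply: measurableC; rewrite -[X in measurable X]setTI; exact: measurable_fun_le.
      by apply/seteqP; split => s /=; [move=> h; apply/negP; rewrite -ltNge|move/negP; rewrite -ltNge].
  rewrite /g /path_derive /=.
  have cX := @continuous_path w 0%N `|s|.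
  suff hs : (s_ n s)%:R / n.+1%:R @[n --> \oo] --> `|s|.
    have h := continuous_cvg _ cX hs; exact (h _).
  apply: (squeeze_cvgr (f := fun n => `|s| - @harmonic R n) (h := fun=> `|s|)).
  - apply: nearW => n; rewrite /s_.
    have /andP[h1 h2] := truncn_itv (mulr_ge0 (ler0n R n.+1) (normr_ge0 s)).
    have n0 : 0 < n.+1%:R :> R by [].
    rewrite ler_pdivrMr// [_ * n.+1%:R]mulrC h1 andbT ler_pdivlMr// mulrBl.
    rewrite mulVf ?gt_eqF// lerBlDr (mulrC `|s|) (le_trans (ltW h2))// -natr1.
    by [].
  - by rewrite -[X in _ --> X]subr0; apply: cvgB; [exact: cvg_cst|exact: cvg_harmonic].
  - exact: cvg_cst.
pose g n (z : measurableTypeR R * T) : R :=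
  n.+1%:R * (path_derive X z.2 j (`|z.1 : R| + n.+1%:R^-1) - path_derive X z.2 j `|z.1 : R|).
apply: (@measurable_fun_cvg _ _ _ _ g) => // [n|[s w] _].
- apply: measurable_funM => //; apply: measurable_funB => //.
  pose sh (z : measurableTypeR R * T) : measurableTypeR R * T := (`|z.1 : R| + n.+1%:R^-1, z.2).
  have msh : measurable_fun setT sh.
    apply/measurable_fun_pairP; split; last exact: measurable_snd.
    apply: measurable_funD => //; exact: (measurableT_comp _ measurable_fst).
  have := measurableT_comp ih msh.
  by apply: eq_measurable_fun => z _; rewrite /= ger0_norm ?addr_ge0.
- have dX : derivable (path_derive X w j) `|s| 1 by exact: (@X_smooth w j `|s|).
  exact (cvg_difference_quotient dX).
Qed.

(** Exchange the integrals over the time and over the probability space, and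
    apply [exp_sqr_path_derive] at each time. *)
Lemma exp_sqr_integral_path j (q : R) : abs_moment mu (2 * j) < q ->
  let W w := (\int[@lebesgue_measure R]_(s in `[0%R, 1%R]) (expR (path_derive X w j s ^+ 2 / (4 * q)))%:E)%E in
  measurable_fun setT W /\ (\int[P]_w W w <= (Num.sqrt 2)%:E)%E.
Proof.
move=> Cq W.
pose f (z : measurableTypeR R * T) : \bar R :=
  ((expR (path_derive X z.2 j `|z.1 : R| ^+ 2 / (4 * q))) * \1_(`[0, 1]%classic : set (measurableTypeR R)) z.1)%:E.
have mf : measurable_fun setT f.
  apply/measurable_EFinP; apply: measurable_funM.
    apply: measurableT_comp => //; apply: measurable_funM => //.
    apply: measurable_funX; exact: measurable_path_derive2.
  by apply: (measurableT_comp (measurable_indic _)).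
have f0 z : (0 <= f z)%E by rewrite lee_fin mulr_ge0// expR_ge0.
have WE w : W w = (\int[@lebesgue_measure R]_s f (s, w))%E.
  rewrite /W integral_mkcond; apply: eq_integral => s _.
  rewrite patchE /f /= indicE; case: ifPn => [/set_mem/=|]; rewrite ?mulr0// mulr1.
  by rewrite in_itv/= => /andP[s0 _]; rewrite ger0_norm.
have WE' : W = fubini_G (@lebesgue_measure R) f by apply/funext => w; rewrite WE.
split; first by rewrite WE'; exact: measurable_fun_fubini_tonelli_G.
under eq_integral do rewrite WE.
rewrite -(fubini_tonelli (m1 := @lebesgue_measure R) (m2 := P) f mf f0).
apply: (@le_trans _ _ (\int[@lebesgue_measure R]_(s in `[0%R, 1%R]) (Num.sqrt 2)%:E)%E); last first.
  have -> : (\int[@lebesgue_measure R]_(s in `[0%R, 1%R]) (Num.sqrt 2)%:E =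
      (Num.sqrt 2)%:E * @lebesgue_measure R `[0%R, 1%R]%classic)%E by exact: integral_cst.
  by rewrite lebesgue_measure_itv/= lte_fin ltr01 oppr0 adde0 mule1.
rewrite [leRHS]integral_mkcond; apply: ge0_le_integral => //.
- by move=> s _; apply: integral_ge0.
- exact: measurable_fun_fubini_tonelli_F.
- apply/(measurable_restrictT _ _).1; [exact: measurable_itv|exact: measurable_cst].
- move=> s _; rewrite patchE /f /= indicE; case: ifPn => sI.
    under eq_integral do rewrite mulr1; exact: exp_sqr_path_derive.
  by under eq_integral do rewrite mulr0; rewrite integral0.
Qed.

End process_small_ball.

(** * Zeros and small derivatives *)

Section rolle.
Context {R : realType}.
Local Notation leb := (@lebesgue_measure R).
Implicit Types (f : R -> R) (a b t M q : R).

(** The zeros are listed in increasing order, so that the theorem of Rolle applies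
    to consecutive values of [z]. *)
Definition zeros_in f a b (m : nat) (z : nat -> R) : Prop :=
  (forall i, (i.+1 < m)%N -> z i < z i.+1) /\
  (forall i, (i < m)%N -> a <= z i <= b /\ f (z i) = 0).

Lemma zeros_in_derive f (f' : R -> R) a b m (z : nat -> R) :
  (forall x : R, is_derive x 1 f (f' x)) ->
  zeros_in f a b m.+1 z -> exists z', zeros_in f' a b m z'.
Proof.
move=> df [zi z0]; have cf := is_derive_continuous df.
have /choice[z' hz'] : forall i, exists u, (i < m)%N -> z i < u < z i.+1 /\ f' u = 0.
  move=> i; have [im|mi] := ltnP i m; last by exists 0.
  have zz := zi i im.
  have [_ f0] := z0 i (ltnW im); have [_ f1] := z0 i.+1 im.
  have derf x : x \in `](z i), (z i.+1)[%R -> derivable f x 1.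
    by move=> _; exact: (@ex_derive _ _ _ _ _ _ _ (df x)).
  have fe : f (z i) = f (z i.+1) by rewrite f0 f1.
  have [c cz dc] := Rolle zz derf (continuous_subspaceT cf) fe.
  exists c => _; split; first by move: cz; rewrite in_itv.
  by rewrite -(@derive_val _ _ _ _ _ _ _ (df c)) (@derive_val _ _ _ _ _ _ _ dc).
exists z'; split => i im.
  have [/andP[_ h1] _] := hz' i (ltnW im); have [/andP[h2 _] _] := hz' i.+1 im.
  exact: lt_trans h1 h2.
have [/andP[h1 h2] h3] := hz' i im; split => //.
have [/andP[az _] _] := z0 i (ltnW im); have [/andP[_ zb] _] := z0 i.+1 im.
by rewrite (le_trans az (ltW h1)) (le_trans (ltW h2) zb).
Qed.

Variable F : nat -> R -> R.
Hypothesis dF : forall j (t : R), is_derive t 1 (F j) (F j.+1 t).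

Lemma zeros_in_derivatives a b m j (z : nat -> R) :
  zeros_in (F 0) a b (j + m) z -> exists z', zeros_in (F j) a b m z'.
Proof.
elim: j m z => [|j ih] m z; first by exists z.
rewrite addSnnS => /ih[z']; exact: zeros_in_derive (dF j).
Qed.

Lemma increment_le_integral j u v M : 0 <= u -> u <= v -> v <= 1 ->
  (\int[leb]_(s in `[0%R, 1%R]) (`|F j.+1 s|)%:E <= M%:E)%E ->
  `|F j v - F j u| <= M.
Proof.
move=> u0 uv v1 FM; have cF := is_derive_continuous (dF j.+1).
rewrite -lee_fin; apply: le_trans FM.
have -> : (`|F j v - F j u|%:E = `|\int[leb]_(s in `[u, v]) (F j.+1 s)%:E|)%E.
  by rewrite (is_derive_integral uv (dF j) cF).
have mF (D : set (measurableTypeR R)) : measurable_fun D (fun s => (F j.+1 s)%:E).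
  by apply: measurable_funTS; apply/measurable_EFinP; exact: continuous_measurable_fun.
apply: (le_trans (le_abse_integral _ _ _)) => //.
apply: ge0_subset_integral => //.
- by apply: measurableT_comp => //.
- by apply: subset_itv; rewrite bnd_simp.
Qed.

Lemma small_between_zero j a b M z t : 0 <= a -> b <= 1 ->
  (\int[leb]_(s in `[0%R, 1%R]) (`|F j.+1 s|)%:E <= M%:E)%E ->
  a <= z <= b -> a <= t <= b -> F j z = 0 -> `|F j t| <= M.
Proof.
move=> a0 b1 FM /andP[az zb] /andP[at' tb] Fz.
have [zt|/ltW tz] := leP z t.
- have := @increment_le_integral j z t M (le_trans a0 az) zt (le_trans tb b1) FM.
  by rewrite Fz subr0.
- have := @increment_le_integral j t z M (le_trans a0 at') tz (le_trans zb b1) FM.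
  by rewrite Fz sub0r normrN.
Qed.

(** By the theorem of Rolle, each [F j] with [j < m] vanishes somewhere in
    [[a, b]]. Starting there, [F m.-1] is bounded by the integral of [|F m|], and
    each derivative of lower order gains a factor [b - a] by the mean value
    theorem. *)
Lemma small_derivatives a b M m (z : nat -> R) : 0 <= a -> b <= 1 ->
  zeros_in (F 0) a b m z ->
  (\int[leb]_(s in `[0%R, 1%R]) (`|F m s|)%:E <= M%:E)%E ->
  forall d j t, (j + d.+1 = m)%N -> a <= t <= b -> `|F j t| <= (b - a) ^+ d * M.
Proof.
move=> a0 b1 zF FM; elim=> [|d ih] j t jdm tab.
  have [z' [_ hz']] : exists z', zeros_in (F j) a b 1 z'.
    by apply: (zeros_in_derivatives (z := z)); rewrite jdm.
  have [zab Fz] := hz' 0%N isT.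
  rewrite expr0 mul1r; apply: (small_between_zero a0 b1 _ zab tab Fz).
  by rewrite -addn1 jdm.
have [z' [_ hz']] : exists z', zeros_in (F j) a b d.+2 z'.
  by apply: (zeros_in_derivatives (z := z)); rewrite jdm.
have [zab Fz] := hz' 0%N isT.
rewrite exprS -mulrA.
have hB s : a <= s <= b -> `|F j.+1 s| <= (b - a) ^+ d * M.
  by apply: ih; rewrite addSnnS.
have cF := is_derive_continuous (dF j).
have ab : a <= b by case/andP: tab => /le_trans; apply.
have M0 : 0 <= (b - a) ^+ d * M := le_trans (normr_ge0 _) (hB t tab).
have [zt|tz] := leP (z' 0%N) t.
  have [c] := @MVT_segment R (F j) (F j.+1) _ _ zt (fun x _ => dF j x) (continuous_subspaceT cF).
  rewrite in_itv/= Fz subr0 => /andP[zc ct] ->.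
  move: zab tab => /andP[az zb] /andP[at' tb].
  rewrite normrM mulrC ler_pM//; last by rewrite hB// (le_trans az zc) (le_trans ct tb).
  by rewrite ger0_norm ?subr_ge0// lerB.
have [c] := @MVT_segment R (F j) (F j.+1) _ _ (ltW tz) (fun x _ => dF j x) (continuous_subspaceT cF).
rewrite in_itv/= Fz sub0r => /andP[zc ct].
move=> /(congr1 Num.norm); rewrite normrN => ->.
move: zab tab => /andP[az zb] /andP[at' tb].
rewrite normrM mulrC ler_pM//; last by rewrite hB// (le_trans at' zc) (le_trans ct zb).
by rewrite ger0_norm ?subr_ge0 ?(ltW tz)// lerB.
Qed.

End rolle.

Section exp_square_integral.
Context {R : realType}.
Local Notation leb := (@lebesgue_measure R).

(** From [1 + u <= exp u] with [u = (y ^ 2 - M ^ 2) / (4 * q)], and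
    [2 * M * |y| <= M ^ 2 + y ^ 2]. *)
Lemma norm_le_exp_sqr (y M q : R) : 0 < M -> 0 < q ->
  `|y| + 2 * q / M <= M + 2 * q / M * expR (- (M ^+ 2 / (4 * q))) * expR (y ^+ 2 / (4 * q)).
Proof.
move=> M0 q0; rewrite -[in leRHS]mulrA -[expR _ * expR _]expRD.
have h := expR_ge1Dx (- (M ^+ 2 / (4 * q)) + y ^+ 2 / (4 * q)).
apply: (@le_trans _ _ (M + 2 * q / M * (1 + (- (M ^+ 2 / (4 * q)) + y ^+ 2 / (4 * q))))).
  have -> : M + 2 * q / M * (1 + (- (M ^+ 2 / (4 * q)) + y ^+ 2 / (4 * q))) =
    (M ^+ 2 + y ^+ 2) / (2 * M) + 2 * q / M by field; rewrite !gt_eqF.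
  rewrite lerD2r ler_pdivlMr ?mulr_gt0//.
  have : 0 <= (M - `|y|) ^+ 2 by exact: sqr_ge0.
  have : y ^+ 2 = `|y| ^+ 2 by rewrite real_normK ?num_real.
  move: (`|y|) => u ->; nra.
by rewrite lerD2l ler_wpM2l// divr_ge0 ?mulr_ge0// ltW.
Qed.

(** Jensen's inequality, by integrating [norm_le_exp_sqr]. *)
Lemma exp_sqr_integral_bound (g : R -> R) (M q : R) : continuous g -> 0 < M -> 0 < q ->
  (\int[leb]_(s in `[0%R, 1%R]) (expR (g s ^+ 2 / (4 * q)))%:E <= (expR (M ^+ 2 / (4 * q)))%:E)%E ->
  (\int[leb]_(s in `[0%R, 1%R]) (`|g s|)%:E <= M%:E)%E.
Proof.
move=> cg M0 q0 gM.
pose I : set (measurableTypeR R) := [set` `[0%R, 1%R]%R].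
have mI : measurable I by exact: measurable_itv.
have lI : leb I = 1%E by rewrite /I lebesgue_measure_itv/= lte_fin ltr01 oppr0 adde0.
have icst (c : R) : (\int[leb]_(s in I) c%:E = c%:E)%E.
  have -> : (\int[leb]_(s in I) c%:E = c%:E * leb I)%E by exact: integral_cst.
  by rewrite lI mule1.
have mg : measurable_fun I g by apply: measurable_funTS; exact: continuous_measurable_fun.
have mng : measurable_fun I (fun s => (`|g s|)%:E).
  by apply/measurable_EFinP; exact: measurableT_comp.
have mexp : measurable_fun I (fun s => (expR (g s ^+ 2 / (4 * q)))%:E).
  apply/measurable_EFinP; apply: measurableT_comp => //; apply: measurable_funM => //.
  exact: measurable_funX.
pose c : R := 2 * q / M.
pose c' : R := c * expR (- (M ^+ 2 / (4 * q))).
have c0 : 0 <= c by rewrite divr_ge0 ?mulr_ge0// ltW.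
have c'0 : 0 <= c' by rewrite mulr_ge0// expR_ge0.
have key : (\int[leb]_(s in I) (`|g s|)%:E + c%:E <= M%:E + c'%:E * \int[leb]_(s in I) (expR (g s ^+ 2 / (4 * q)))%:E)%E.
  rewrite -[X in (_ + X <= _)%E]icst -[X in (_ <= X + _)%E]icst.
  have e1 : (\int[leb]_(s in I) (`|g s|)%:E + \int[leb]_(s in I) c%:E = \int[leb]_(s in I) ((`|g s|)%:E + c%:E))%E.
    apply/esym; apply: ge0_integralD.
    + exact: mI.
    + by move=> s _; rewrite lee_fin.
    + exact: mng.
    + by move=> s _; rewrite lee_fin.
    + exact: measurable_cst.
  have e2 : (c'%:E * \int[leb]_(s in I) (expR (g s ^+ 2 / (4 * q)))%:E = \int[leb]_(s in I) (c'%:E * (expR (g s ^+ 2 / (4 * q)))%:E))%E.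
    apply/esym; apply: ge0_integralZl.
    + exact: mI.
    + exact: mexp.
    + by move=> s _; rewrite lee_fin expR_ge0.
    + by rewrite lee_fin.
  have mc : measurable_fun I (fun s => (c'%:E * (expR (g s ^+ 2 / (4 * q)))%:E)%E).
    exact: measurable_funeM.
  have e3 : (\int[leb]_(s in I) M%:E + \int[leb]_(s in I) (c'%:E * (expR (g s ^+ 2 / (4 * q)))%:E) = \int[leb]_(s in I) (M%:E + c'%:E * (expR (g s ^+ 2 / (4 * q)))%:E))%E.
    apply/esym; apply: ge0_integralD.
    + exact: mI.
    + by move=> s _; rewrite lee_fin ltW.
    + exact: measurable_cst.
    + by move=> s _; rewrite -EFinM lee_fin mulr_ge0// expR_ge0.
    + exact: mc.
  rewrite e1 e2 e3; apply: ge0_le_integral.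
  - exact: mI.
  - by move=> s _; rewrite -EFinD lee_fin addr_ge0.
  - by apply: emeasurable_funD; [exact: mng | exact: measurable_cst].
  - by apply: emeasurable_funD; [exact: measurable_cst | exact: mc].
  - by move=> s _; rewrite -EFinD -EFinM -EFinD lee_fin; exact: norm_le_exp_sqr.
have kc : (M%:E + c'%:E * \int[leb]_(s in I) (expR (g s ^+ 2 / (4 * q)))%:E <= M%:E + c%:E)%E.
  rewrite leeD2lE//.
  have h : (c'%:E * \int[leb]_(s in I) (expR (g s ^+ 2 / (4 * q)))%:E <= c'%:E * (expR (M ^+ 2 / (4 * q)))%:E)%E.
    by apply: lee_wpmul2l => //; rewrite lee_fin.
  apply: (le_trans h).
  by rewrite -EFinM lee_fin /c' -mulrA -expRD addNr expR0 mulr1.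
have := le_trans key kc.
by have [fc fle] : c%:E \is a fin_num /\ True by []; rewrite leeD2rE.
Qed.

End exp_square_integral.

(** * Counting zeros *)

Section counting_zeros.
Context {R : realType}.
Implicit Types (f : R -> R) (a b t : R).

Lemma zeros_in_homo f a b m (z : nat -> R) i j : zeros_in f a b m z ->
  (i <= j)%N -> (j < m)%N -> z i <= z j.
Proof.
move=> [zi _]; elim: j => [|j ih]; first by rewrite leqn0 => /eqP ->.
rewrite leq_eqVlt => /orP[/eqP ->//|]; rewrite ltnS => ij jm.
by apply: le_trans (ih ij (ltnW jm)) _; apply: ltW; exact: zi.
Qed.

Lemma zeros_in_inj f a b m (z : nat -> R) i j : zeros_in f a b m z ->
  (i < m)%N -> (j < m)%N -> z i = z j -> i = j.
Proof.
move=> zf; wlog ij : i j / (i < j)%N.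
  move=> h im jm zij; case: (ltngtP i j) => // [ij|ji]; first exact: h.
  by apply/esym; apply: h.
move=> _ jm zij; have := zeros_in_homo zf ij jm.
have [zi _] := zf; have := zi i (leq_ltn_trans ij jm).
by rewrite zij => /lt_le_trans h /h; rewrite ltxx.
Qed.

Lemma le_counting_zeros f n :
  (n%:R%:E <= counting [set x : R | x \in `[0%R, 1%R] /\ f x = 0%R] :> \bar R)%E <->
  exists z, zeros_in f 0 1 n z.
Proof.
set Z := [set x : R | _]; split.
- move=> h.
  have [B BZ Bn] : exists2 B : {fset R}, [set` B] `<=` Z & (n <= size (B : seq R))%N.
    have [fZ|iZ] := pselect (finite_set Z); last exact: infinite_set_fset.
    exists (fset_set Z); first by move=> x /=; rewrite in_fset_set// => /set_mem.
    by move: h; rewrite /counting asboolT// lee_fin ler_nat.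
  pose s := sort <=%O (B : seq R).
  have ss : sorted <%O s by rewrite sort_lt_sorted fset_uniq.
  have sn : (n <= size s)%N by rewrite size_sort.
  exists (nth 0 s); split => i ilt.
    by apply: (sorted_ltn_nth lt_trans) => //; rewrite inE; apply: leq_trans sn => //; exact: ltnW.
  have : nth 0 s i \in B.
    by rewrite -(mem_sort <=%O); apply: mem_nth; exact: leq_trans sn.
  by move=> /BZ [] ; rewrite in_itv.
- move=> [z zf]; rewrite /counting; case: ifPn => [/asboolP fZ|_]; last exact: leey.
  rewrite lee_fin ler_nat -[leqLHS](size_iota 0 n) -(size_map z).
  apply: uniq_leq_size.
    rewrite map_inj_in_uniq ?iota_uniq// => i j; rewrite !mem_iota !add0n/=.
    exact: zeros_in_inj zf.
  move=> x /mapP[i]; rewrite mem_iota add0n/= => im ->.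
  have [_ /(_ i im)[z01 fz]] := zf.
  by rewrite in_fset_set//; apply/mem_set; rewrite /Z/= in_itv.
Qed.

(** Otherwise, by induction on [i <= N], the zero number [m * i] would lie
    beyond [i / N], strictly when [0 < i]; for [i = N] it would exceed [1]. *)
Lemma zeros_pigeonhole f n N m (z : nat -> R) : (0 < N)%N -> (m * N < n)%N ->
  zeros_in f 0 1 n z -> exists2 i, (i < N)%N &
  exists z', zeros_in f (i%:R / N%:R) (i.+1%:R / N%:R) m.+1 z'.
Proof.
move=> N0 mNn zf; apply: contrapT => no; have [zi z01] := zf.
have h i : (i <= N)%N -> i%:R / N%:R < z (m * i)%N ?<= if (i == 0)%N.
  elim: i => [_|i ih iN]; first by rewrite mul0r muln0; have [/andP[]] := z01 0%N (leq_ltn_trans (leq0n _) mNn).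
  have lt_n k : (k <= m * i.+1)%N -> (k < n)%N.
    by move=> kn; apply: leq_ltn_trans kn (leq_ltn_trans _ mNn); rewrite leq_mul2l iN orbT.
  rewrite /= ltNge; apply/negP => zle; apply: no; exists i => //.
  exists (fun k => z (m * i + k)%N); split => k km.
    by rewrite addnS; apply: zi; apply: lt_n; rewrite mulnS -addnS [leqRHS]addnC leq_add2l.
  have kn : (m * i + k < n)%N by apply: lt_n; rewrite mulnS [leqRHS]addnC leq_add2l.
  have [_ fz] := z01 _ kn; split => //; apply/andP; split.
    by apply: le_trans (lteifW (ih (ltnW iN))) _; apply: (zeros_in_homo zf) => //; rewrite leq_addr.
  apply: le_trans zle; apply: (zeros_in_homo zf); last exact: lt_n.
  by rewrite mulnS [leqRHS]addnC leq_add2l.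
have := h N (leqnn N); rewrite gtn_eqF//= divff ?pnatr_eq0 ?gtn_eqF//.
have [/andP[_ z1'] _] := z01 _ mNn.
by rewrite ltNge z1'.
Qed.
End counting_zeros.

Section measurable_zeros.
Context d (T : measurableType d) (R : realType) (Y : R -> T -> R).
Hypothesis mY : forall t, measurable_fun setT (Y t).
Hypothesis cY : forall w, continuous (fun t => Y t w).

(** A zero in [[a, b]] is detected by arbitrarily small values on a
    countable dense subset. *)
Lemma measurable_zero_itv (a b : R) :
  measurable [set w | exists2 x, a <= x <= b & Y x w = 0].
Proof.
have [ba|ab] := ltP b a.
  rewrite (_ : [set w | _] = set0)//; apply/seteqP; split => // w [x /andP[ax xb] _].
  by have := le_lt_trans (le_trans ax xb) ba; rewrite ltxx.
pose D := [set q : rat | 0 <= (ratr q : R) <= 1].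
pose r (q : rat) : R := a + (b - a) * ratr q.
rewrite (_ : [set w | _] = \bigcap_(j : nat) \bigcup_(q : rat)
   (if q \in D then [set w | `|Y (r q) w| < j.+1%:R^-1] else set0)); last first.
  apply/seteqP; split => w.
    move=> [x /andP[ax xb] Yx] j _ /=.
    have : continuous (fun s => Y (a + (b - a) * s) w).
      move=> s; apply: (@continuous_comp _ _ _ (fun s => a + (b - a) * s) (fun t => Y t w)); last exact: cY.
      by apply: cvgD; [exact: cvg_cst|apply: cvgM; [exact: cvg_cst|exact: cvg_id]].
    have [s s01 sx] : exists2 s, 0 <= s <= 1 & x = a + (b - a) * s.
      have [e|ab'] := eqVneq a b.
        exists 0; rewrite ?lexx ?ler01// mulr0 addr0.
        by apply/le_anti/andP; split => //; rewrite e.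
      have ba0 : 0 < b - a by rewrite subr_gt0 lt_neqAle ab' ab.
      exists ((x - a) / (b - a)); last by rewrite mulrCA divff ?gt_eqF// mulr1 addrC subrK.
      by rewrite divr_ge0 ?subr_ge0//= ler_pdivrMr// mul1r lerB.
    move=> /(_ s) /cvgrPdist_lt /(_ j.+1%:R^-1); rewrite invr_gt0 ltr0Sn => /(_ isT).
    rewrite -sx Yx => -[e /= e0 he].
    have [q] : exists q, ratr q \in `](Num.max 0 (s - e)), (Num.min 1 (s + e))[%R.
      apply: rat_in_itvoo; move: s01 => /andP[s0 s1].
      by rewrite gt_max !lt_min; apply/andP; split; apply/andP; split; lra.
    rewrite in_itv/= gt_max lt_min => /andP[/andP[q0 qs] /andP[q1 qs']].
    exists q => //; rewrite ifT/=; last by apply/mem_set; rewrite /D/= (ltW q0) (ltW q1).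
    rewrite -[X in X < _]normrN -[X in `|X| < _]sub0r; apply: he => /=.
    by rewrite ltr_norml; apply/andP; split; lra.
  move=> h.
  have cn : continuous (fun t => `|Y t w|).
    by move=> t; apply: cvg_norm; exact: cY.
  have [c] := @EVT_min R (fun t => `|Y t w|) a b ab (continuous_subspaceT cn).
  rewrite in_itv/= => cab hc; exists c => //.
  apply/eqP; rewrite -normr_le0 leNgt; apply/negP => c0.
  have [j _ /= jc] : exists2 j, True & j.+1%:R^-1 < `|Y c w|.
    exists (Num.truncn (`|Y c w|^-1)) => //.
    by rewrite invf_plt ?posrE// truncnS_gt.
  have [q _] := h j I; case: ifPn => // /set_mem; rewrite /D/= => /andP[q0 q1].
  apply/negP; rewrite -leNgt; apply: le_trans (ltW jc) _; apply: hc.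
  rewrite in_itv/= /r lerDl mulr_ge0 ?subr_ge0//=.
  rewrite -lerBrDl -[leRHS]mulr1 ler_wpM2l ?subr_ge0//.
apply: bigcapT_measurable => j; apply: bigcupT_measurable_rat => q.
case: ifP => // _.
rewrite (_ : [set w | _] = setT `&` (fun w => `|Y (r q) w|) @^-1` [set y | y < j.+1%:R^-1]); last by rewrite setTI.
have m1 : measurable_fun setT (fun w => `|Y (r q) w|) by apply: measurableT_comp => //; exact: mY.
apply: m1 => //.
by rewrite -set_itvNyo; exact: measurable_itv.
Qed.

(** Recursion on the number of zeros, a rational being inserted between
    consecutive zeros. *)
Lemma measurable_zeros n :
  measurable [set w | exists z, zeros_in (fun t => Y t w) 0 1 n z].
Proof.
pose Z n a := [set w | exists z, zeros_in (fun t => Y t w) 0 1 n z /\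
  forall i, (i < n)%N -> a < z i].
have ZS m a : Z m.+1 a = \bigcup_(q : rat) ((\bigcup_(j : nat)
   [set w | exists2 x, Num.max 0 (a + j.+1%:R^-1) <= x <= Num.min 1 (ratr q) & Y x w = 0])
   `&` Z m (ratr q)).
  apply/seteqP; split => w.
    move=> [z [zf az]]; have [zi z01] := zf.
    have [q /andP[zq qz]] : exists q : rat, z 0%N < ratr q < (if m is 0 then z 0%N + 1 else z 1%N).
      have [|q] := @rat_in_itvoo R (z 0%N) (if m is 0 then z 0%N + 1 else z 1%N).
        by case: m zf az zi z01 => [|m] zf az zi z01; [rewrite ltrDl|exact: zi].
      by rewrite in_itv; exists q.
    exists q => //; split.
      have [/andP[z0 z1] Yz] := z01 0%N isT.
      exists (Num.truncn ((z 0%N - a)^-1)) => //.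
      exists (z 0%N) => //.
      rewrite ge_max le_min z0 z1 (ltW zq)/= andbT -lerBrDl.
      by rewrite invf_ple ?posrE ?subr_gt0 ?az// ltW// truncnS_gt.
    exists (z \o S); split; first split => i im; [exact: zi|exact: z01|].
    move=> i im; case: m qz im zf {zi z01 az} => // m qz im zf.
    by apply: lt_le_trans qz _; exact: (zeros_in_homo zf).
  move=> [q _ [[j _ [x]]]].
  rewrite ge_max le_min => /andP[/andP[x0 ax] /andP[x1 xq]] Yx [z [[zi z01] qz]].
  have ax' : a < x by apply: lt_le_trans ax; rewrite ltrDl.
  exists (fun i => if i is i'.+1 then z i' else x); split; first split.
  - by move=> [|i] im /=; [apply: (le_lt_trans xq); exact: qz|exact: zi].
  - by move=> [|i] im /=; [rewrite x0 x1|exact: z01].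
  - by move=> [|i] im //=; apply: (lt_trans ax'); apply: (le_lt_trans xq); exact: qz.
have mZ m a : measurable (Z m a).
  elim: m a => [|m ih] a.
    rewrite (_ : Z 0%N a = setT)//; apply/seteqP; split => // w _.
    by exists (fun=> 0); split => //; split.
  rewrite ZS; apply: bigcupT_measurable_rat => q; apply: measurableI => //.
  by apply: bigcupT_measurable => j; exact: measurable_zero_itv.
rewrite (_ : [set w | _] = Z n (-1)); first exact: mZ.
apply/seteqP; split => w; last by move=> [z [zf _]]; exists z.
move=> [z zf]; exists z; split => // i im; have [_ /(_ i im)[/andP[z0 _] _]] := zf.
by apply: lt_le_trans z0; rewrite oppr_lt0.
Qed.

End measurable_zeros.

(** * The two ways of having many zeros *)

Section many_zeros.
Context (R : realType) (d : measure_display) (T : measurableType d)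
  (P : probability T R) (X : R -> {RV P >-> R}).
Variable mu : probability (measurableTypeR R) R.
Hypotheses (X_gaussian : gaussian_process X) (X_centered : centered X)
  (X_stationary : stationary X) (X_smooth : smooth_paths X)
  (X_mu : is_spectral_measure X mu) (mu_moments : finite_moments mu).

Lemma is_derive_path_derive w j (t : R) :
  is_derive t 1 (path_derive X w j) (path_derive X w j.+1 t).
Proof.
have h := @X_smooth w j t.
by rewrite /path_derive derive1nS derive1E; exact: DeriveDef.
Qed.

Lemma measurable_nb_zeros_ge n : measurable [set w | (n%:R%:E <= nb_zeros01 X w)%E].
Proof.
rewrite (_ : [set w | _] = [set w | exists z, zeros_in (fun t => X t w) 0 1 n z]); last first.
  by apply/seteqP; split => w /= h; apply/le_counting_zeros.
apply: (@measurable_zeros _ _ _ (fun t w => X t w)) => [t|w].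
  exact: measurable_funPT.
exact: (is_derive_continuous (is_derive_path_derive w 0)).
Qed.

Lemma markov_ge0 (W : T -> \bar R) (a B : R) : (forall w, (0 <= W w)%E) ->
  measurable_fun setT W -> (\int[P]_w W w <= B%:E)%E -> 0 < a ->
  (P [set w | (a%:E <= W w)%E] <= (B / a)%:E)%E.
Proof.
move=> W0 mW WB a0.
have mA : measurable [set w | (a%:E <= W w)%E].
  by rewrite -[X in measurable X]setTI; exact: emeasurable_fun_c_infty.
have h : (a%:E * P [set w | (a%:E <= W w)%E] <= B%:E)%E.
  apply: le_trans WB.
  rewrite -integral_cst//; apply: (@le_trans _ _ (\int[P]_(w in [set w | (a%:E <= W w)%E]) W w)%E).
    apply: ge0_le_integral => //; first by move=> w _; rewrite lee_fin ltW.
    exact: measurable_funTS.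
  by apply: ge0_subset_integral.
by rewrite EFinM muleC lee_pdivlMl.
Qed.

(** If there are [n] zeros in [[0, 1]], one of [N] cells of equal length contains
    [m.+1] of them. Unless the derivative of order [m.+1] is large in the mean,
    which is the first term, all the lower derivatives are then small at the
    left end of that cell, which is the second one. *)
Lemma many_zeros_bound (mu_ac : has_nontrivial_ac_part mu) :
  exists2 D : R, 1 <= D & forall (n N m k : nat) (M q : R),
    (0 < N)%N -> (m * N < n)%N -> (0 < k)%N -> (k.*2 <= m)%N -> 0 < M ->
    abs_moment mu (2 * m.+1) < q ->
    (P [set w | (n%:R%:E <= nb_zeros01 X w)%E] <=
     (Num.sqrt 2 * expR (- (M ^+ 2 / (4 * q))) +
      N%:R * (expR (1 / 2) * (N%:R^-1 ^+ (m - k.*2) * M) *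
       (k%:R * (D * (D * k.*2%:R) ^+ (4 * k)))) ^+ k)%:E)%E.
Proof.
have [D D1 hD] := derivatives_small_ball X_gaussian X_centered X_stationary X_smooth X_mu mu_moments mu_ac.
exists D => // n N m k M q N0 mNn k0 km M0 Cq.
have q0 : 0 < q.
  by apply: le_lt_trans Cq; apply: Rintegral_ge0 => x _; rewrite exprn_ge0.
have N0' : 0 < N%:R :> R by rewrite ltr0n.
pose eta := N%:R^-1 ^+ (m - k.*2) * M.
have eta0 : 0 < eta by rewrite mulr_gt0// exprn_gt0// invr_gt0.
have [mW EW] := exp_sqr_integral_path X_gaussian X_centered X_stationary X_smooth X_mu mu_moments Cq.
set W := fun w => _ in mW EW.
pose A (i : nat) := [set w | forall j, (j < k)%N -> (`|path_derive X w j.*2 (i%:R / N%:R)| <= eta)%R].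
pose B := [set w | ((expR (M ^+ 2 / (4 * q)))%:E <= W w)%E].
have mA i : measurable (A i).
  rewrite (_ : A i = \bigcap_(j in [set j | (j < k)%N]) [set w | (`|path_derive X w j.*2 (i%:R / N%:R)| <= eta)%R]); last first.
    by apply/seteqP; split.
  apply: bigcap_measurableType => j _.
  rewrite (_ : [set w | _] = setT `&` (fun w => `|path_derive X w j.*2 (i%:R / N%:R)|) @^-1` [set y | y <= eta]); last by rewrite setTI.
  have m1 : measurable_fun setT (fun w => `|path_derive X w j.*2 (i%:R / N%:R)|).
    by apply: measurableT_comp => //; apply: measurable_path_derive.
  by apply: m1 => //; rewrite -set_itvNyc; exact: measurable_itv.
have mB : measurable B.
  by rewrite -[X in measurable X]setTI; exact: emeasurable_fun_c_infty.
have W0 w : (0 <= W w)%E by apply: integral_ge0 => s _; rewrite lee_fin expR_ge0.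
(* either the derivative of order m.+1 is large in the mean, or all the even
   derivatives of order below 2k are small at some point i / N *)
have sub : [set w | (n%:R%:E <= nb_zeros01 X w)%E] `<=` B `|` \big[setU/set0]_(i < N) A i.
  move=> w /= /le_counting_zeros[z zf].
  have [//|Wlt] := leP (expR (M ^+ 2 / (4 * q)))%:E (W w); first by left.
  right; rewrite -bigcup_mkord.
  have [i iN [z' zf']] := zeros_pigeonhole N0 mNn zf.
  exists i => // j jk.
  have cF := is_derive_continuous (is_derive_path_derive w m.+1).
  have FM := exp_sqr_integral_bound cF M0 q0 (ltW Wlt).
  have a0 : 0 <= i%:R / N%:R :> R by rewrite divr_ge0.
  have b1 : i.+1%:R / N%:R <= 1 :> R by rewrite ler_pdivrMr// mul1r ler_nat.
  have ba : i.+1%:R / N%:R - i%:R / N%:R = N%:R^-1 :> R.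
    by rewrite -mulrBl -natrB// subSnn mul1r.
  have j2 : (j.*2 <= m)%N by apply: leq_trans km; rewrite leq_double ltnW.
  have e : (j.*2 + (m - j.*2).+1 = m.+1)%N by rewrite addnS subnKC.
  have h := small_derivatives (is_derive_path_derive w) a0 b1 zf' FM e (t := i%:R / N%:R).
  apply: (le_trans (h _)).
    by rewrite lexx/= ler_pM2r ?invr_gt0// ler_nat.
  rewrite ba /eta; apply: ler_wpM2r; first exact: ltW.
  apply: ler_wiXn2l.
  - by rewrite invr_ge0 ltW.
  - by rewrite invf_le1// ler1n.
  - by apply: leq_sub2l; rewrite leq_double ltnW.
apply: (@le_trans _ _ (P (B `|` \big[setU/set0]_(i < N) A i))).
  apply: le_measure => //; rewrite inE; first exact: measurable_nb_zeros_ge.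
  by apply: measurableU => //; apply: bigsetU_measurable.
apply: (le_trans (measureU2 _ _ _)) => //; first by apply: bigsetU_measurable.
rewrite EFinD; apply: leeD.
  have := markov_ge0 W0 mW EW (expR_gt0 (M ^+ 2 / (4 * q))).
  by rewrite expRN.
apply: (le_trans (Boole_inequality _ _)) => //.
apply: (@le_trans _ _ (\sum_(i < N) ((expR (1 / 2) * eta * (k%:R * (D * (D * k.*2%:R) ^+ (4 * k)))) ^+ k)%:E)%E).
  by apply: lee_sum => i _; exact: hD.
rewrite sumEFin lee_fin -/eta sumr_const card_ord.
by rewrite [leRHS]mulr_natl.
Qed.

End many_zeros.

(** * Choice of the scales *)

Section parameters.
Context {R : realType}.

(** The choice of the scales, in terms of [L = ln n] and of a power [g] of
    [L]: about [n ^ (1 / 2)] cells, [eps * g] zeros in one of them and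
    [g / L] derivatives. *)
Lemma tail_parameters (eps D L g : R) (n : nat) :
  0 < eps -> 1 <= D -> expR L = n%:R -> 4 <= L -> 1 <= g ->
  384 <= eps * L -> 320 <= eps * g -> 4 * D * g <= expR (L / 2) ->
  4 * eps * g <= expR (L / 2) -> 32 * L <= eps * g ^+ 2 ->
  exists N m k : nat, let M := expR (m%:R * L / 16) in
    [/\ (0 < N)%N, (m * N < n)%N, (0 < k)%N & (k.*2 <= m)%N] /\
    m.+1%:R <= 2 * eps * g /\
    Num.sqrt 2 * expR (- (M ^+ 2 / (4 * (2 * M)))) +
      N%:R * (expR (1 / 2) * (N%:R^-1 ^+ (m - k.*2) * M) *
       (k%:R * (D * (D * k.*2%:R) ^+ (4 * k)))) ^+ k <=
    3 * expR (- (Num.min (eps / 64) ((eps / 64) ^+ 2) * g ^+ 2)).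
Proof.
move=> e0 D1 Ln L4 g1 eL eg Dg eg' Lg.
have L0 : 0 < L by lra.
have g0 : 0 < g by lra.
have D0 : 0 <= D by lra.
pose N := Num.truncn (expR (L / 2)).
pose m := (Num.truncn (eps * g)).+1.
pose k := (Num.truncn (g / L)).+1.
have Nle : N%:R <= expR (L / 2) by rewrite truncn_le// expR_ge0.
have Nge : expR (L / 4) <= N%:R.
  have h1 : expR (L / 2) < N.+1%:R by rewrite truncnS_gt.
  have h2 : 2 <= expR (L / 4) by apply: le_trans (expR_ge1Dx _); lra.
  have h3 : expR (L / 2) = expR (L / 4) ^+ 2 by rewrite -expRM_natl; congr expR; lra.
  move: h1; rewrite -natr1 h3 => h1; nra.
have N0 : 0 < N%:R :> R by apply: lt_le_trans Nge; exact: expR_gt0.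
have mge : eps * g <= m%:R by rewrite ltW// truncnS_gt.
have mle : m%:R <= eps * g + 1.
  by rewrite -natr1 lerD2r truncn_le// mulr_ge0// ltW.
have kge : g / L <= k%:R by rewrite ltW// truncnS_gt.
have kle : k%:R <= g / L + 1.
  by rewrite -natr1 lerD2r truncn_le// divr_ge0// ltW.
have kg : k%:R * L <= g + L.
  have -> : g + L = (g / L + 1) * L by rewrite mulrDl mul1r divfK ?gt_eqF.
  by rewrite ler_pM2r.
have km : 4 * k%:R <= m%:R :> R.
  have : 4 * (g / L) <= eps * g / 2.
    rewrite mulrA ler_pdivrMr//; nra.
  by move=> h; lra.
exists N, m, k => M; split; [split|split] => //.
- by move: N0; rewrite ltr0n.
- rewrite -(ltr_nat R) natrM -Ln (_ : expR L = expR (L / 2) * expR (L / 2)); last first.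
    by rewrite -expRD; congr expR; lra.
  apply: (@le_lt_trans _ _ (m%:R * expR (L / 2))); first by rewrite ler_wpM2l.
  rewrite ltr_pM2r ?expR_gt0//; apply: lt_le_trans eg'; lra.
- rewrite -(ler_nat R) -mul2n natrM; have := ler0n R k; lra.
- by rewrite -natr1; lra.
pose x := m%:R * L / 16.
have x0 : 0 <= x by rewrite divr_ge0// mulr_ge0// ltW.
(* the double exponential beats any power of L; a square of it is enough *)
have first : expR (- (M ^+ 2 / (4 * (2 * M)))) <= expR (- ((eps / 64) ^+ 2 * g ^+ 2)).
  rewrite ler_expR lerN2.
  have M0 : 0 < M by exact: expR_gt0.
  have -> : M ^+ 2 / (4 * (2 * M)) = M / 8 by field; rewrite gt_eqF.
  have h1 : 1 + x ^+ 2 / 2 <= M by have := expR_ge1Dxn 1 x0.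
  have h2 : eps * g / 16 <= x.
    rewrite /x; have : eps * g * 1 <= m%:R * L by apply: ler_pM => //; [rewrite mulr_ge0// ltW|lra].
    by move=> h; lra.
  have h3 : (eps * g / 16) ^+ 2 <= x ^+ 2 by rewrite lerXn2r// ?nnegrE// divr_ge0// mulr_ge0// ltW.
  have -> : (eps / 64) ^+ 2 * g ^+ 2 = (eps * g / 16) ^+ 2 / 16 by field.
  by lra.
(* the gain N ^ -(m / 2) is of order exp (- m L / 8), and M takes back half of it *)
have inner : expR (1 / 2) * (N%:R^-1 ^+ (m - k.*2) * M) *
       (k%:R * (D * (D * k.*2%:R) ^+ (4 * k))) <= expR (- (m%:R * L / 32)).
  have i1 : N%:R^-1 ^+ (m - k.*2) * M <= expR (- x).
    have -> : expR (- x) = expR (- (L / 4) * (m%:R / 2)) * M.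
      by rewrite -expRD; congr expR; rewrite /x; lra.
    rewrite ler_pM2r ?expR_gt0//.
    apply: (@le_trans _ _ (expR (- (L / 4)) ^+ (m - k.*2))).
      rewrite lerXn2r ?nnegrE ?expR_ge0 ?invr_ge0//.
      by rewrite expRN lef_pV2 ?posrE ?expR_gt0.
    rewrite -expRM_natr ler_expR.
    have : m%:R / 2 <= (m - k.*2)%:R :> R.
      rewrite natrB; last by rewrite -(ler_nat R) -mul2n natrM; have := ler0n R k; lra.
      by rewrite -mul2n natrM; lra.
    by move=> h; rewrite ler_wnM2l//; lra.
  have i2 : k%:R * (D * (D * k.*2%:R) ^+ (4 * k)) <= expR (5 * (k%:R * L)).
    have k1 : 1 <= k%:R :> R by rewrite ler1n.
    have b1 : k%:R * D <= D * k.*2%:R by rewrite -mul2n natrM; nra.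
    have b2 : D * k.*2%:R <= expR L.
      rewrite -mul2n natrM.
      have : g / L <= g by rewrite ler_pdivrMr//; nra.
      have : expR (L / 2) <= expR L by rewrite ler_expR; lra.
      move=> h1 h2; apply: (le_trans _ h1); apply: (le_trans _ Dg).
      have : D * k%:R <= D * (2 * g) by apply: ler_wpM2l => //; lra.
      by move=> h3; lra.
    have b0 : 0 <= D * k.*2%:R by rewrite mulr_ge0//; lra.
    rewrite mulrA; apply: (@le_trans _ _ (expR L * expR L ^+ (4 * k))).
      apply: ler_pM.
      - by rewrite mulr_ge0.
      - exact: exprn_ge0.
      - exact: le_trans b1 b2.
      - by rewrite lerXn2r ?nnegrE ?expR_ge0.
    rewrite -expRM_natl -expRD ler_expR natrM; nra.
  apply: (@le_trans _ _ (expR (1 / 2) * expR (- x) * expR (5 * (k%:R * L)))).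
    apply: ler_pM => //.
    - by rewrite mulr_ge0 ?expR_ge0// mulr_ge0 ?expR_ge0// exprn_ge0// invr_ge0.
    - by rewrite mulr_ge0// mulr_ge0 ?exprn_ge0 ?mulr_ge0.
    - by rewrite ler_pM2l ?expR_gt0.
  rewrite -!expRD ler_expR /x.
  have : eps * g * L <= m%:R * L by rewrite ler_pM2r.
  have : 384 * g <= eps * L * g by rewrite ler_pM2r.
  have : 320 * L <= eps * g * L by rewrite ler_pM2r.
  by move=> h1 h2 h3; lra.
(* k m L is of order g ^ 2, which absorbs the number N of cells *)
have second : N%:R * (expR (1 / 2) * (N%:R^-1 ^+ (m - k.*2) * M) *
       (k%:R * (D * (D * k.*2%:R) ^+ (4 * k)))) ^+ k <= expR (- (eps / 64 * g ^+ 2)).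
  apply: (@le_trans _ _ (expR (L / 2) * expR (- (m%:R * L / 32)) ^+ k)).
    apply: ler_pM => //.
      apply: exprn_ge0; rewrite mulr_ge0// mulr_ge0// ?expR_ge0// ?mulr_ge0 ?expR_ge0// ?exprn_ge0 ?invr_ge0 ?mulr_ge0//.
    rewrite lerXn2r// ?nnegrE ?expR_ge0//.
    by rewrite mulr_ge0// mulr_ge0// ?expR_ge0// ?mulr_ge0 ?expR_ge0// ?exprn_ge0 ?invr_ge0 ?mulr_ge0//.
  rewrite -expRM_natl -expRD ler_expR.
  have : eps * g ^+ 2 <= k%:R * (m%:R * L).
    have -> : eps * g ^+ 2 = g / L * (eps * g * L) by field; rewrite gt_eqF.
    apply: ler_pM => //; [by rewrite divr_ge0// ltW|by rewrite mulr_ge0 ?mulr_ge0// ltW|].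
    by rewrite ler_pM2r.
  by move=> h; lra.
set c := Num.min _ _.
have sq2 : Num.sqrt 2 <= 2 :> R.
  have : Num.sqrt 2 <= Num.sqrt (2 ^+ 2) :> R by apply: ler_wsqrtr; lra.
  by rewrite sqrtr_sqr ger0_norm.
have -> : 3 * expR (- (c * g ^+ 2)) = 2 * expR (- (c * g ^+ 2)) + expR (- (c * g ^+ 2)) by lra.
have g2 : 0 <= g ^+ 2 by exact: sqr_ge0.
apply: lerD.
  apply: ler_pM; rewrite ?expR_ge0 ?sqrtr_ge0//; apply: (le_trans first).
  by rewrite ler_expR lerN2 ler_wpM2r// ge_min lexx orbT.
apply: (le_trans second).
by rewrite ler_expR lerN2 ler_wpM2r// ge_min lexx.
Qed.

(** From [ln (s * L) < s * L] with [s = 1 / (4 * a)]. *)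
Lemma powR_le_expR (B a : R) : 0 < B -> 0 < a ->
  exists A, forall L, A <= L -> B * L `^ a <= expR (L / 2).
Proof.
move=> B0 a0; pose s := (4 * a)^-1.
have s0 : 0 < s by rewrite invr_gt0 mulr_gt0.
pose A := 4 * (B * expR (- (a * ln s))).
have A0 : 0 < A by rewrite !mulr_gt0// expR_gt0.
exists A => L AL; have L0 : 0 < L := lt_le_trans A0 AL.
rewrite /powR gt_eqF//.
have h : a * ln L <= L / 4 + - (a * ln s).
  have : ln (s * L) <= s * L by rewrite ltW// ln_sublinear// mulr_gt0.
  rewrite lnM ?posrE// => h1.
  have -> : L / 4 = a * (s * L) by rewrite /s; field; rewrite gt_eqF.
  by rewrite -mulrN -mulrDr ler_pM2l//; lra.
apply: (@le_trans _ _ (B * (expR (L / 4) * expR (- (a * ln s))))).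
  by rewrite ler_pM2l// -expRD ler_expR.
have -> : expR (L / 2) = expR (L / 4) * expR (L / 4) by rewrite -expRD; congr expR; lra.
rewrite mulrCA ler_pM2l ?expR_gt0//; apply: le_trans (expR_ge1Dx _).
by move: AL; rewrite /A; lra.
Qed.

Lemma powR_ge (A a : R) : 0 < a -> exists B, forall L, B <= L -> A <= L `^ a.
Proof.
move=> a0; exists (Num.max 1 (Num.max 0 A `^ a^-1)) => L.
rewrite ge_max => /andP[L1 AL].
apply: (@le_trans _ _ (Num.max 0 A)); first by rewrite le_max lexx orbT.
have h : Num.max 0 A = (Num.max 0 A `^ a^-1) `^ a.
  by rewrite -powRrM mulVf ?gt_eqF// powRr1// le_max lexx.
by rewrite h ge0_ler_powR// ?nnegrE ?powR_ge0// ?ltW//; lra.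
Qed.

End parameters.

(** * The tail of the number of zeros *)

Section tail.
Context (R : realType) (d : measure_display) (T : measurableType d)
  (P : probability T R) (X : R -> {RV P >-> R}).
Variables (mu : probability (measurableTypeR R) R) (gamma K0 : R).
Hypotheses (X_gaussian : gaussian_process X) (X_centered : centered X)
  (X_stationary : stationary X) (X_smooth : smooth_paths X)
  (X_mu : is_spectral_measure X mu) (mu_moments : finite_moments mu)
  (mu_ac : has_nontrivial_ac_part mu)
  (gamma_gt : 1 / 2 < gamma) (K0_gt0 : 0 < K0)
  (moment_growth : forall n : nat, (1 <= n)%N ->
      ln (abs_moment mu n) <= K0 * n%:R `^ (1 + 1 / gamma)).

(** [many_zeros_bound] with the scales of [tail_parameters] for [g = L ^ gamma]; the
    constant [eps] there is such that the growth of the moments gives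
    [C_(2 (m+1)) <= exp (m L / 16)]. Small values of [n] are absorbed in [K]. *)
Lemma nb_zeros_tail : exists K c : R, [/\ 0 < K, 0 < c &
  forall n : nat, (1 <= n)%N ->
    (P [set w | n%:R%:E <= nb_zeros01 X w] <=
     (K * expR (- (c * ln n%:R `^ (2 * gamma))))%:E)%E].
Proof.
have gam0 : 0 < gamma by apply: lt_trans gamma_gt; rewrite divr_gt0.
have [D D1 hD] := many_zeros_bound X_gaussian X_centered X_stationary X_smooth X_mu mu_moments mu_ac.
(* then 2 (m + 1) <= (r L) ^ gamma, hence K0 (2 (m + 1)) ^ (1 / gamma) <= L / 64 *)
pose r : R := (64 * K0)^-1.
have r0 : 0 < r by rewrite invr_gt0 mulr_gt0.
pose eps : R := r `^ gamma / 4.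
have e0 : 0 < eps by rewrite divr_gt0// powR_gt0.
pose c : R := Num.min (eps / 64) ((eps / 64) ^+ 2).
have e64 : 0 < eps / 64 by rewrite divr_gt0.
have c0 : 0 < c by rewrite lt_min e64/= exprn_gt0.
have [A1 h1] := powR_ge (Num.max 1 (320 / eps)) gam0.
have g21 : 0 < 2 * gamma - 1.
  by rewrite subr_gt0 mulrC -ltr_pdivrMr.
have [A2 h2] := powR_ge (32 / eps) g21.
have [A3 h3] := powR_le_expR (mulr_gt0 (ltr0n R 4) (lt_le_trans ltr01 D1)) gam0.
have [A4 h4] := powR_le_expR (mulr_gt0 (ltr0n R 4) e0) gam0.
pose A : R := \big[Num.max/4]_(a <- [:: 384 / eps; A1; A2; A3; A4]) a.
have hA L : A <= L -> [/\ 4 <= L, 384 / eps <= L, A1 <= L, A2 <= L & (A3 <= L) && (A4 <= L)].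
  rewrite /A !big_cons big_nil !ge_max.
  by move=> /and5P[a b c' d' /andP[e f]]; rewrite d' e; split.
exists (3 + expR (c * A `^ (2 * gamma))), c; split => //.
move=> n n1; have n0 : 0 < n%:R :> R by rewrite ltr0n.
have [LA|AL] := ltP (ln n%:R) A.
  apply: (@le_trans _ _ 1%E); first exact: probability_le1 (measurable_nb_zeros_ge X_smooth n).
  rewrite lee_fin mulrDl -expRD; apply: ler_wpDl; first by rewrite mulr_ge0// expR_ge0.
  rewrite -[leLHS]expR0 ler_expR subr_ge0 ler_pM2l// ge0_ler_powR ?nnegrE//.
  - by rewrite mulr_ge0// ltW.
  - by rewrite ln_ge0// ler1n.
  - by apply: le_trans (ltW LA); rewrite ln_ge0// ler1n.
  - exact: ltW.
set L := ln n%:R in AL *.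
have [L4 eL L1 L2 /andP[L3 L4']] := hA L AL.
have L0 : 0 < L by lra.
pose g : R := L `^ gamma.
have Ln : expR L = n%:R by rewrite lnK.
have := h1 L L1; rewrite ge_max => /andP[g1 eg].
have g2 : L `^ (2 * gamma) = g ^+ 2 by rewrite mulrC powRrM powR_mulrn// powR_ge0.
have Lg : 32 * L <= eps * g ^+ 2.
  rewrite -g2 -(mulr_powRB1 (ltW L0)); last lra.
  have := h2 L L2; rewrite ler_pdivrMr// => h; nra.
have eL' : 384 <= eps * L by rewrite mulrC -ler_pdivrMr.
have eg' : 320 <= eps * g by rewrite mulrC -ler_pdivrMr.
have [N [m [k]]] := tail_parameters e0 D1 Ln L4 g1 eL' eg' (h3 L L3) (h4 L L4') Lg.
set M := expR (m%:R * L / 16) => -[[N0 mNn k0 km] [mg bound]].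
have M0 : 0 < M by exact: expR_gt0.
have m0 : (0 < m)%N by apply: leq_trans km; rewrite double_gt0.
have CM : abs_moment mu (2 * m.+1) < 2 * M.
  have [C0|C0] := ltP 0 (abs_moment mu (2 * m.+1)); last by apply: le_lt_trans C0 _; rewrite mulr_gt0.
  apply: (@le_lt_trans _ _ M); last by rewrite ltr_pMl// ltr1n.
  rewrite -(lnK (C0 : _ \is Num.pos)) ler_expR.
  have := moment_growth (n := 2 * m.+1) isT.
  move=> /le_trans; apply.
  have y0 : 0 < (2 * m.+1)%:R :> R by rewrite ltr0n muln_gt0.
  rewrite powRD; last by rewrite (gt_eqF y0) implybT.
  rewrite powRr1; last exact: ltW.
  have h : (2 * m.+1)%:R `^ (1 / gamma) <= r * L.
    have -> : r * L = ((r * L) `^ gamma) `^ (1 / gamma).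
      by rewrite -powRrM mul1r divff ?gt_eqF// powRr1// mulr_ge0// ltW.
    rewrite ge0_ler_powR ?nnegrE ?powR_ge0//; first by rewrite divr_ge0// ltW.
    rewrite (powRM _ (ltW r0) (ltW L0)) natrM.
    have -> : r `^ gamma * L `^ gamma = 2 * (2 * eps * L `^ gamma) by rewrite /eps; field.
    by rewrite ler_pM2l.
  apply: (@le_trans _ _ (K0 * ((2 * m.+1)%:R * (r * L)))).
    by rewrite ler_pM2l// ler_pM2l.
  have -> : K0 * ((2 * m.+1)%:R * (r * L)) = m.+1%:R * L / 32.
    by rewrite natrM /r; field; rewrite gt_eqF.
  have : m.+1%:R <= 2 * m%:R :> R by rewrite -natrM ler_nat mul2n -addnn -addn1 leq_add2l.
  by rewrite -(ler_pM2r L0) => hm; lra.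
apply: (le_trans (hD n N m k M (2 * M) N0 mNn k0 km M0 CM)).
rewrite lee_fin; apply: (le_trans bound); rewrite -/c g2 ler_pM2r ?expR_gt0//.
by rewrite lerDl expR_ge0.
Qed.

End tail.

(** * Moments from tails *)

Section moments.
Context {R : realType}.

(** The exponent changes sign at [L = (t / c) ^ (1 / a)]. *)
Lemma linear_sub_powR_le (a c t L : R) : 0 < a -> 0 < c -> 0 <= t -> 0 <= L ->
  t * L - c * L `^ (1 + a) <= t * (t / c) `^ (1 / a).
Proof.
move=> a0 c0 t0 L0.
have -> : L `^ (1 + a) = L * L `^ a.
  rewrite -(mulr_powRB1 L0 (addr_gt0 ltr01 a0)); congr (_ * _ `^ _).
  by rewrite addrC addKr.
have [cL|Lc] := leP t (c * L `^ a).
  apply: (@le_trans _ _ 0); last by rewrite mulr_ge0// powR_ge0.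
  have : t * L <= c * L `^ a * L by rewrite ler_wpM2r.
  by rewrite (mulrC L) mulrA subr_le0.
apply: (@le_trans _ _ (t * L)).
  by rewrite lerBlDr lerDl mulr_ge0 ?mulr_ge0 ?powR_ge0// ltW.
apply: ler_wpM2l => //.
have -> : L = (L `^ a) `^ (1 / a) by rewrite -powRrM mul1r divff ?gt_eqF// powRr1.
rewrite ge0_ler_powR ?nnegrE ?powR_ge0 ?divr_ge0 ?(ltW a0) ?(ltW c0)//.
by rewrite ler_pdivlMr// mulrC ltW.
Qed.

(** Compare with the telescoping series of the [1 / n - 1 / n.+1]. *)
Lemma nneseries_inv_sqr_le (S : R) : 0 <= S ->
  (\sum_(n <oo) (S / n.+1%:R ^+ 2)%:E <= (2 * S)%:E)%E.
Proof.
move=> S0.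
have h (N : nat) : \sum_(i < N.+1) (i.+1%:R ^+ 2)^-1 <= 2 - N.+1%:R^-1 :> R.
  elim: N => [|N ih]; first by rewrite big_ord1 expr1n invr1; lra.
  rewrite big_ord_recr/=; apply: (le_trans (lerD ih (lexx _))).
  have x0 : 0 < N.+1%:R :> R by rewrite ltr0n.
  have e : N.+2%:R = N.+1%:R + 1 :> R by rewrite -natr1.
  rewrite e; move: (N.+1%:R) x0 => x x0.
  have : ((x + 1) ^+ 2)^-1 <= x^-1 - (x + 1)^-1.
    have -> : x^-1 - (x + 1)^-1 = (x * (x + 1))^-1 by field; rewrite !gt_eqF//; lra.
    rewrite lef_pV2 ?posrE; [|nra|nra]; nra.
  by move=> h; lra.
apply: lime_le; first by apply: is_cvg_nneseries => n _ _; rewrite lee_fin divr_ge0// exprn_ge0.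
apply: nearW => -[|N]; first by rewrite big_mkord big_ord0 lee_fin mulr_ge0.
rewrite big_mkord sumEFin lee_fin -mulr_sumr mulrC ler_wpM2r//.
by apply: (le_trans (h N)); rewrite lerBlDr lerDl invr_ge0.
Qed.

Context d (T : measurableType d) (P : probability T R).
Variable Z : T -> \bar R.
Hypothesis Znat : forall w, Z w = +oo%E \/ exists n : nat, Z w = n%:R%:E.
Hypothesis mZ : forall n : nat, measurable [set w | (n%:R%:E <= Z w)%E].

(** For a real [x], the event [x <= Z] is the intersection over the naturals
    [n < x] of the events [n.+1 <= Z]. *)
Lemma measurable_extended_nat : measurable_fun setT Z.
Proof.
move=> mD; apply: (measurability _ (ErealGenCInfty.measurableE R)) => //.
move=> /= _ [_ [x ->] <-]; rewrite setTI.
rewrite (_ : _ @^-1` _ = \bigcap_(n in [set n : nat | n%:R < x]) [set w | (n.+1%:R%:E <= Z w)%E]).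
  by apply: bigcap_measurableType => n _.
apply/seteqP; split => w /=.
  rewrite in_itv/= andbT => xZ n /= nx; case: (Znat w) => [->|[k Zk]]; first exact: leey.
  move: xZ; rewrite Zk !lee_fin => /(lt_le_trans nx).
  by rewrite ltr_nat ler_nat.
move=> h; rewrite in_itv/= andbT; case: (Znat w) => [->|[k Zk]]; first exact: leey.
rewrite leNgt Zk lte_fin; apply/negP => kx.
by have := h k kx; rewrite /= Zk lee_fin ler_nat ltnn.
Qed.

Lemma measurable_expe (f : T -> \bar R) m : measurable_fun setT f ->
  measurable_fun setT (fun w => (f w ^+ m)%E).
Proof.
move=> mf; elim: m => [|m ih]; first by under eq_fun do rewrite expe0; exact: measurable_cst.
by under eq_fun do rewrite expeS; exact: emeasurable_funM.
Qed.

(** Pointwise, [Z ^ m] is one of the terms [n ^ m] with [n <= Z] when [Z] is finite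
    and positive, and these terms are unbounded when [Z] is infinite. *)
Lemma moment_le_tail_sum m : (0 < m)%N ->
  (\int[P]_w (Z w ^+ m) <=
   \sum_(n <oo) ((n.+1%:R ^+ m)%:E * P [set w | (n.+1%:R%:E <= Z w)%E]))%E.
Proof.
move=> m0; pose A n := [set w | (n.+1%:R%:E <= Z w)%E].
pose f n w : \bar R := ((n.+1%:R ^+ m) * \1_(A n) w)%:E.
have f0 n w : (0 <= f n w)%E by rewrite lee_fin mulr_ge0// exprn_ge0.
have mf n : measurable_fun setT (f n).
  by apply/measurable_EFinP; apply: measurable_funM => //; exact: measurable_indic (mZ _).
have If n : (\int[P]_w f n w = (n.+1%:R ^+ m)%:E * P (A n))%E.
  rewrite /f; under eq_integral do rewrite EFinM.
  rewrite ge0_integralZl ?lee_fin ?exprn_ge0//; last first.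
    by apply/measurable_EFinP; exact: measurable_indic (mZ _).
  by rewrite (integral_indic _ _ (mZ _))// setIT.
under eq_eseriesr do rewrite -If.
rewrite -integral_nneseries//.
have Z0 w : (0 <= Z w)%E.
  by case: (Znat w) => [->|[k ->]]; rewrite ?leey ?lee_fin.
(* each term of the series that the value of Z activates is a lower bound *)
have key w n : (n.+1%:R%:E <= Z w)%E -> ((n.+1%:R ^+ m)%:E <= \sum_(n <oo) f n w)%E.
  move=> nZ.
  have fn : f n w = (n.+1%:R ^+ m)%:E by rewrite /f indicE mem_set// mulr1.
  rewrite -fn; apply: (@le_trans _ _ (\sum_(0 <= i < n.+1) f i w)%E).
    by rewrite big_nat_recr//= leeDr// sume_ge0.
  exact: nneseries_lim_ge.
apply: ge0_le_integral => //.
- by move=> w _; exact: expe_ge0.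
- exact: measurable_expe measurable_extended_nat.
- by apply: ge0_emeasurable_sum => //.
move=> w _; case: (Znat w) => [Zw|[[|k] Zw]].
- apply: (le_trans (leey _)); rewrite leye_eq; apply/eqP/eqyP => r r0.
  pose k := Num.truncn r.
  apply: (@le_trans _ _ (k.+1%:R ^+ m)%:E); last by apply: key; rewrite Zw leey.
  rewrite lee_fin; apply: (@le_trans _ _ k.+1%:R); first by rewrite ltW// truncnS_gt.
  by rewrite -natrX ler_nat; case: m m0 {f f0 mf If key} => // m _; rewrite expnS leq_pmulr// expn_gt0.
- rewrite Zw; case: m m0 {f0 mf If key} @f => // m _ f; rewrite expeS mul0e.
  by apply: nneseries_ge0 => n _ _; rewrite lee_fin mulr_ge0// exprn_ge0.
- by rewrite Zw -EFin_expe; apply: key; rewrite Zw.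
Qed.

(** With [L = ln n], the term [n ^ m * P (n <= Z)] is at most [K * n ^ -2] times the
    exponential of [(m + 2) * L - c * L ^ (1 + a)], which [linear_sub_powR_le]
    bounds by a multiple of [m ^ (1 + 1 / a)]. *)
Lemma moments_of_tail (K c a : R) : 0 < K -> 0 < c -> 0 < a ->
  (forall n : nat, (1 <= n)%N ->
    (P [set w | (n%:R%:E <= Z w)%E] <= (K * expR (- (c * ln n%:R `^ (1 + a))))%:E)%E) ->
  exists2 c' : R, 0 < c' & forall m : nat, (1 <= m)%N ->
    (\int[P]_w (Z w ^+ m) <= (expR (c' * m%:R `^ (1 + 1 / a)))%:E)%E.
Proof.
move=> K0 c0 a0 tail.
pose C : R := 3 * (3 / c) `^ (1 / a).
have C0 : 0 < C by rewrite mulr_gt0// powR_gt0// divr_gt0.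
exists (2 * K + C) => [|m m1]; first by rewrite addr_gt0// mulr_gt0.
have m0 : 0 < m%:R :> R by rewrite ltr0n.
have mp1 : 1 <= m%:R `^ (1 + 1 / a) :> R.
  rewrite -[leLHS](powRr0 m%:R) ler_powR ?ler1n//.
  by rewrite addr_ge0// divr_ge0// ltW.
apply: (le_trans (moment_le_tail_sum m1)).
pose E := expR (C * m%:R `^ (1 + 1 / a)).
apply: (@le_trans _ _ (\sum_(n <oo) ((K * E) / n.+1%:R ^+ 2)%:E)%E); last first.
  apply: (le_trans (nneseries_inv_sqr_le _)); first by rewrite mulr_ge0// ?ltW// expR_gt0.
  rewrite lee_fin mulrA [(_ + C) * _]mulrDl expRD -/E ler_pM2r ?expR_gt0//.
  have : 2 * K <= 2 * K * m%:R `^ (1 + 1 / a) by rewrite ler_peMr// mulr_ge0// ltW.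
  by move=> h; apply: le_trans (expR_ge1Dx _); lra.
apply: lee_nneseries => n _; first by rewrite mule_ge0// lee_fin exprn_ge0.
move: (tail n.+1 isT) => h.
apply: (le_trans (lee_wpmul2l _ h)); first by rewrite lee_fin exprn_ge0.
rewrite -EFinM lee_fin mulrCA -mulrA ler_pM2l// ler_pdivlMr ?exprn_gt0//.
set L := ln n.+1%:R.
have L0 : 0 <= L by rewrite ln_ge0// ler1n.
have -> : n.+1%:R = expR L by rewrite lnK// posrE ltr0n.
rewrite mulrAC -exprD -expRM_natl -expRD ler_expR.
apply: (le_trans (linear_sub_powR_le a0 c0 _ L0)) => //.
have t3 : (m + 2)%:R <= 3 * m%:R :> R by rewrite -natrM ler_nat mulSn leq_add2l mul2n -[2%N]/(1.*2)%N leq_double.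
rewrite powRD; last by rewrite (gt_eqF m0) implybT.
rewrite powRr1; last exact: ltW.
have -> : C * (m%:R * m%:R `^ (1 / a)) = 3 * m%:R * (3 * m%:R / c) `^ (1 / a).
  have c3 : 0 <= 3 / c by rewrite divr_ge0// ltW.
  by rewrite [3 * m%:R / c]mulrAC (powRM _ c3 (ltW m0)) /C; ring.
apply: ler_pM => //; first exact: powR_ge0.
rewrite ge0_ler_powR ?nnegrE ?divr_ge0 ?mulr_ge0 ?(ltW c0) ?(ltW a0)//.
by rewrite ler_pM2r// invr_gt0.
Qed.

End moments.

(** * The number of zeros of a stationary Gaussian process *)

Theorem mainTheorem6 (R : realType) (d : measure_display)
    (T : measurableType d) (P : probability T R) (X : R -> {RV P >-> R})
    (mu : probability (measurableTypeR R) R) (gamma K0 : R)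
    (X_gaussian : gaussian_process X)
    (X_centered : centered X)
    (X_stationary : stationary X)
    (X_smooth : smooth_paths X)
    (X_mu : is_spectral_measure X mu)
    (mu_symmetric : symmetric_measure mu)
    (mu_ac : has_nontrivial_ac_part mu)
    (mu_moments : finite_moments mu)
    (gamma_gt : 1 / 2 < gamma)
    (K0_gt0 : 0 < K0)
    (moment_growth : forall n : nat, (1 <= n)%N ->
      ln (abs_moment mu n) <= K0 * n%:R `^ (1 + 1 / gamma)) :
  (exists K c : R, [/\ 0 < K, 0 < c &
     forall n : nat, (1 <= n)%N ->
       (P [set w | n%:R%:E <= nb_zeros01 X w] <=
        (K * expR (- (c * ln n%:R `^ (2 * gamma))))%:E)%E]) /\
  (exists c : R, 0 < c /\
     forall m : nat, (1 <= m)%N ->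
       (\int[P]_w (nb_zeros01 X w ^+ m) <=
        (expR (c * m%:R `^ (1 + 1 / (2 * gamma - 1))))%:E)%E).
Proof.
have [K [c [K0' c0 tail]]] := nb_zeros_tail X_gaussian X_centered X_stationary
  X_smooth X_mu mu_moments mu_ac gamma_gt K0_gt0 moment_growth.
split; first by exists K, c.
have a0 : 0 < 2 * gamma - 1 by lra.
have Znat w : nb_zeros01 X w = +oo%E \/ exists n : nat, nb_zeros01 X w = n%:R%:E.
  rewrite /nb_zeros01 /counting; case: ifP => _; last by left.
  by right; eexists.
have tail' n : (1 <= n)%N -> (P [set w | n%:R%:E <= nb_zeros01 X w] <=
    (K * expR (- (c * ln n%:R `^ (1 + (2 * gamma - 1)))))%:E)%E.
  by rewrite addrC subrK; exact: tail.
have [c' c'0 hc'] :=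
  moments_of_tail Znat (measurable_nb_zeros_ge X_smooth) K0' c0 a0 tail'.
by exists c'.
Qed.
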